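(* Let $Y$ be a Young set and let $H$ be a finite abelian group. (1) The contravariant functor $E:\mathrm{Set}^{\mathrm{inj}}\to\mathrm{Set}$ defined on objects by $N\mapsto\operatorname{Fun}(Y_N,\widehat H)$ and on morphisms by $w\mapsto(F\mapsto F\circ Y_w)$ is a coherent exponential $R$-species: it is the exponential of the contravariant functor $\mathrm{Set}^\times\to\mathrm{Set}^\times$ given by $N\mapsto\operatorname{Fun}(Y_N,\widehat H)_{\mathrm{prim}}$. (2) The Hopf algebra $\mathcal B^\Delta_{Y,H}$ is isomorphic to the Hopf algebra $\mathcal B_E$ associated to the coherent exponential species $E$.
   Context: $\mathrm{Set}$, $\mathrm{Set}^{\mathrm{inj}}$, $\mathrm{Set}^\times$ are the categories of finite sets with all maps, injective maps, bijective maps respectively. A Young set is a functor $Y:\mathrm{Set}^{\mathrm{inj}}\to\mathrm{Set}^{\mathrm{inj}}$, $N\mapsto Y_N$, $w\mapsto Y_w$, with $Y_\emptyset=\emptyset$ and $Y_K\cap Y_L=Y_{K\cap L}$ for all subsets $K,L$ of the same finite set $N$; for $K\subseteq N$, $Y_K$ is regarded as a subset of $Y_N$ via the injection induced by inclusion. For $N=K\sqcup L$, $Y_{K,L}=Y_K\sqcup Y_L\subseteq Y_N$; for $K\subseteq N$, $K^c=N\setminus K$. $\Bbbk$ is an algebraically closed field of characteristic zero. $\widehat H$ is a set of representatives of the isomorphism classes of irreducible $\Bbbk$-representations of $H$ and $\operatorname{triv}_H\in\widehat H$ is the trivial one. $\operatorname{Fun}(Y_N,\widehat H)$ is the set of functions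 $F:Y_N\to\widehat H$, $\operatorname{supp}F=\{y:F(y)\ne\operatorname{triv}_H\}$. For $F_K\in\operatorname{Fun}(Y_K,\widehat H)$ and $F_L\in\operatorname{Fun}(Y_L,\widehat H)$ ($K,L$ disjoint), $F_K\sqcup F_L\in\operatorname{Fun}(Y_{K\sqcup L},\widehat H)$ equals $F_K$ on $Y_K$, $F_L$ on $Y_L$, and $\operatorname{triv}_H$ elsewhere. For $N\neq\emptyset$, $F\in\operatorname{Fun}(Y_N,\widehat H)$ is primitive if $\operatorname{supp}F\not\subseteq Y_{K,K^c}$ for every nonempty proper subset $K\subsetneq N$; the empty function $F_\emptyset\in\operatorname{Fun}(Y_\emptyset,\widehat H)$ is not primitive. $\operatorname{Fun}(Y_N,\widehat H)_{\mathrm{prim}}$ is the set of primitive functions (with bijections acting by $F\mapsto F\circ Y_w$). The Hopf algebra $\mathcal B^\Delta_{Y,H}$ (for $H$ abelian): $\mathcal B=\big(\bigoplus_NR(\operatorname{Fun}(Y_N,H))\big)_{\mathrm{Set}^\times}$, where $R$ denotes the Grothendieck group of finite-dimensional $\Bbbk$-representations and the subscript denotes coinvariants under transport along bijections. It is free abelian with basis the classes of the irreducible representations $\pi_F:f\mapsto\bigotimes_{y\in Y_N}F(y)(f(y))$, $F\in\operatorname{Fun}(Y_N,\widehat H)$, with $\pi_F=\pi_{wF}$ for bijections $w:N\to M$, $(wF)(y)=F(Y_w^{-1}y)$. It is graded with $\pi_F$ in degree $\#N$; $\pi_{F_K}\pi_{F_L}=\pi_{F_K\sqcup F_L}$; the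 unit is $\pi_{F_\emptyset}$; the comultiplication is $\Delta_{\mathcal B}\pi_F=\sum_{K\subseteq N}\pi_{F|_{Y_K}}\otimes\pi_{F|_{Y_{K^c}}}$; the counit is $1$ on $\pi_{F_\emptyset}$ and $0$ on all other $\pi_F$. Species terminology (Schmitt). An $R$-species is a contravariant functor $E$ from $\mathrm{Set}^{\mathrm{inj}}$ to $\mathrm{Set}$; for $K\subseteq N$ and $s\in E[N]$, $s|_K\in E[K]$ denotes the image of $s$ under the map induced by the inclusion. For a contravariant functor $P$ on $\mathrm{Set}^\times$ with $P[\emptyset]=\emptyset$, the exponential $\exp P$ is the contravariant functor on $\mathrm{Set}^\times$ sending $N$ to the set of assemblies of $P$-structures on $N$, i.e. families $\{p_i\mid i\in I\}$ with $p_i\in P[L_i]$, where $\{L_i\mid i\in I\}$ is a partition of $N$ into nonempty blocks. An $R$-species $E$ is exponential if its restriction to $\mathrm{Set}^\times$ is (identified with) $\exp P$ for some such $P$; then for disjoint $K,L$ and $s\in E[K]$, $t\in E[L]$, $s\sqcup t\in E[K\sqcup L]$ denotes the union of the assemblies. It is coherent if for every finite set $N$, every assembly $s=\{p_i\mid i\in I\}\in E[N]$ (with $p_i\in P[L_i]$, where $\{L_i\mid i\in I\}$ is a partition of $N$ into nonempty blocks) and every $K\subseteq N$ one has $s|_K=\bigsqcup_i p_i|_{K\cap L_i}$, where $p_i$ is regarded as a one-member assembly in $E[L_i]$. (In the case at hand the identification with assemblies sends $\{F_i\}$ to $\bigsqcup_iF_i$.) The Hopf algebra $\mathcal B_E$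 of a coherent exponential $R$-species $E$ is the free abelian group on isomorphism classes $[s]$ of $E$-structures ($s\in E[N]$, $N$ a finite set, modulo transport along bijections), with product $[s][t]=[s\sqcup t]$, coproduct $\Delta[s]=\sum_{K\subseteq N}[s|_K]\otimes[s|_{N\setminus K}]$, unit the class of the empty assembly, and counit $1$ on that class and $0$ on all others. *)

(* Defs.v *)
From HB Require Import structures.
From mathcomp Require Import all_boot all_order all_algebra.
From mathcomp Require Import all_fingroup all_solvable all_character.
From mathcomp Require Import boolp freeg.

Set Implicit Arguments.
Unset Strict Implicit.
Unset Printing Implicit Defensive.

Import GRing.Theory.
Local Open Scope ring_scope.
Local Open Scope quotient_scope.

Record inj (N M : finType) := Inj {
  inj_fun :> N -> M;
  inj_inj : injective inj_fun }.

Record bij (N M : finType) := Bij {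
  bij_inj :> inj N M;
  bij_bij : bijective bij_inj }.

Definition id_inj (N : finType) : inj N N := Inj (@inj_id N).

Definition comp_inj (N M L : finType) (v : inj M L) (w : inj N M) : inj N L :=
  Inj (inj_comp (@inj_inj M L v) (@inj_inj N M w)).

Definition id_bij (N : finType) : bij N N :=
  @Bij N N (id_inj N) (Bijective (frefl _) (frefl _)).

Definition comp_bij (N M L : finType) (v : bij M L) (w : bij N M) : bij N L :=
  @Bij N L (comp_inj v w) (bij_comp (bij_bij v) (bij_bij w)).

Lemma inj_ext (N M : finType) (v w : inj N M) : v =1 w -> v = w.
Proof.
case: v w => [v vi] [w wi] /= /funext e; rewrite -{w}e in wi *.
by congr Inj; apply: Prop_irrelevance.
Qed.

Lemma bij_ext (N M : finType) (v w : bij N M) : v =1 w -> v = w.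
Proof.
case: v w => [v vb] [w wb] /= /inj_ext e; case: w / e wb => wb.
by congr Bij; apply: Prop_irrelevance.
Qed.

Definition sub (N : finType) (K : {set N}) : finType := {x : N | x \in K}.

Definition incl (N : finType) (K : {set N}) : inj (sub K) N :=
  Inj (@val_inj _ _ (sub K)).

(* [incl K @^-1: L] is K :&: L, seen as a subset of K. *)
Lemma incl_cap_subproof (N : finType) (K L : {set N})
  (x : sub (incl K @^-1: L)) : incl K (val x) \in L.
Proof. by have := valP x; rewrite inE. Qed.

Definition incl_cap_fun (N : finType) (K L : {set N})
    (x : sub (incl K @^-1: L)) : sub L :=
  exist _ (incl K (val x)) (incl_cap_subproof x).

Lemma incl_cap_inj (N : finType) (K L : {set N}) : injective (@incl_cap_fun N K L).
Proof. by move=> x y /(congr1 val) /= /val_inj /val_inj. Qed.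

Definition incl_cap (N : finType) (K L : {set N}) :
    inj (sub (incl K @^-1: L)) (sub L) :=
  Inj (@incl_cap_inj N K L).

Definition corestr_fun (N M : finType) (w : inj N M) (L : {set N})
    (x : sub L) : sub (w @: L) :=
  exist _ (w (val x)) (imset_f w (valP x)).

Lemma corestr_inj (N M : finType) (w : inj N M) (L : {set N}) :
  injective (@corestr_fun N M w L).
Proof. by move=> x y /(congr1 val) /= /inj_inj /val_inj. Qed.

Lemma corestr_bij (N M : finType) (w : inj N M) (L : {set N}) :
  bijective (@corestr_fun N M w L).
Proof.
apply: inj_card_bij; first exact: corestr_inj.
by rewrite !card_sig card_imset //; apply: inj_inj.
Qed.

Definition corestr (N M : finType) (w : inj N M) (L : {set N}) :
    bij (sub L) (sub (w @: L)) :=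
  @Bij _ _ (Inj (@corestr_inj N M w L)) (corestr_bij w L).

Lemma incl_setT_bij (N : finType) (L : {set N}) :
  L = [set: N] -> bijective (incl L).
Proof.
move=> ->; apply: inj_card_bij; first exact: inj_inj.
by rewrite card_sig cardsT.
Qed.

Definition incl_setT (N : finType) (L : {set N}) (e : L = [set: N]) :
    bij (sub L) N :=
  Bij (incl_setT_bij e).

(* Every finite set N has a standard copy 'I_#|N|.  The finite sets 'I_n
   replace the proper class of all finite sets when isomorphism classes,
   direct sums over N or coinvariants are formed below. *)
Definition std (N : finType) : inj 'I_#|N| N := Inj (@enum_val_inj N (mem N)).

Record youngSet := YoungSet {
  Yob :> finType -> finType;
  Ymap : forall N M : finType, inj N M -> inj (Yob N) (Yob M);
  Ymap_id : forall (N : finType) (y : Yob N), Ymap (id_inj N) y = y;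
  Ymap_comp : forall (N M L : finType) (v : inj M L) (w : inj N M) (y : Yob N),
    Ymap (comp_inj v w) y = Ymap v (Ymap w y);
  Yvoid : Yob void -> False;
  Ycap : forall (N : finType) (K L : {set N}),
    [set Ymap (incl K) y | y : Yob (sub K)]
      :&: [set Ymap (incl L) y | y : Yob (sub L)]
    = [set Ymap (incl (K :&: L)) y | y : Yob (sub (K :&: L))] }.

Arguments Ymap Y [N M] w : rename.

(* Y_K as a subset of Y_N *)
Definition Ysub (Y : youngSet) (N : finType) (K : {set N}) : {set Y N} :=
  [set Ymap Y (incl K) y | y : Y (sub K)].

Record rspecies := RSpecies {
  rob :> finType -> finType;
  res : forall N M : finType, inj N M -> rob M -> rob N;
  res_id : forall (N : finType) (s : rob N), res (id_inj N) s = s;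
  res_comp : forall (N M L : finType) (v : inj M L) (w : inj N M) (s : rob L),
    res (comp_inj v w) s = res w (res v s) }.

Record bspecies := BSpecies {
  bob :> finType -> finType;
  bmap : forall N M : finType, bij N M -> bob M -> bob N;
  bmap_id : forall (N : finType) (s : bob N), bmap (id_bij N) s = s;
  bmap_comp : forall (N M L : finType) (v : bij M L) (w : bij N M) (s : bob L),
    bmap (comp_bij v w) s = bmap w (bmap v s) }.

Arguments res E [N M] w s : rename.
Arguments bmap P [N M] w s : rename.

(* [s|_K] *)
Definition restr (E : rspecies) (N : finType) (K : {set N}) (s : E N) : E (sub K) :=
  res E (incl K) s.

Section Assemblies.

Variable P : bspecies.

(* An assembly on N assigns to each subset of N at most one P-structure, in
   such a way that the subsets carrying one (the blocks) form a partition of N;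
   [partition] requires the blocks to be nonempty. *)
Definition assembly (N : finType) : finType :=
  {a : {dffun forall L : {set N}, option (P (sub L))}
     | partition [set L | isSome (a L)] [set: N]}.

Definition on_block (N : finType) (a : assembly N) (L : {set N}) :
  option (P (sub L)) := val a L.

Definition block (N : finType) (a : assembly N) : finType :=
  {L : {set N} | isSome (on_block a L)}.

Definition the_some (T : Type) (o : option T) : isSome o -> T :=
  match o with Some x => fun _ => x | None => fun h => False_rect T (notF h) end.

(* The structure p_i carried by the block L_i *)
Definition member (N : finType) (a : assembly N) (L : block a) :
  P (sub (val L)) := the_some (valP L).

Lemma assembly_ext (N : finType) (a b : assembly N) :
  (forall L, on_block a L = on_block b L) -> a = b.
Proof. by move=> e; apply/val_inj/ffunP. Qed.

Lemma block_gt0 (N : finType) (a : assembly N) (L : block a) :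
  (0 < #|sub (val L)|)%N.
Proof.
rewrite card_sig card_gt0; apply/negP=> /eqP L0.
case/and3P: (valP a) => _ _; rewrite inE => /negP; apply.
by have := valP L; rewrite L0.
Qed.

Definition exp_map_fun (N M : finType) (w : bij N M) (a : assembly M) :
    {dffun forall L : {set N}, option (P (sub L))} :=
  [ffun L : {set N} => omap (bmap P (corestr w L)) (on_block a (w @: L))].

Lemma exp_map_subproof (N M : finType) (w : bij N M) (a : assembly M) :
  partition [set L | isSome (exp_map_fun w a L)] [set: N].
Proof.
have isS L : isSome (exp_map_fun w a L) = isSome (on_block a (w @: L)).
  by rewrite ffunE; case: (on_block a _).
have wI := @inj_inj _ _ w.
case/and3P: (valP a) => /eqP cov triv non0; apply/and3P; split.
- apply/eqP/setP=> x; rewrite inE; apply/bigcupP.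
  have: w x \in cover [set L | isSome (val a L)] by rewrite cov inE.
  case/bigcupP=> B; rewrite inE => aB wxB.
  have wB: w @: (w @^-1: B) = B.
    apply/setP=> y; apply/imsetP/idP => [[z]|yB]; first by rewrite inE => ? ->.
    case: (bij_bij w) => g _ gK; exists (g y); last by rewrite gK.
    by rewrite inE gK.
  by exists (w @^-1: B); rewrite !inE // isS wB.
- apply/trivIsetP=> A B; rewrite !inE !isS => aA aB neqAB.
  have /trivIsetP/(_ (w @: A) (w @: B)) := triv.
  rewrite !inE -![val a _]/(on_block a _) => /(_ aA aB) dis.
  rewrite -setI_eq0 -(inj_eq (imset_inj wI)) imset0 imsetI; last first.
    by move=> x y _ _ /wI.
  by rewrite setI_eq0 dis // (inj_eq (imset_inj wI)).
- by rewrite inE isS imset0; rewrite inE in non0.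
Qed.

Definition exp_map (N M : finType) (w : bij N M) (a : assembly M) : assembly N :=
  Sub (exp_map_fun w a) (exp_map_subproof w a).

Lemma on_block_exp_map (N M : finType) (w : bij N M) (a : assembly M) L :
  on_block (exp_map w a) L = omap (bmap P (corestr w L)) (on_block a (w @: L)).
Proof. by rewrite /on_block /= ffunE. Qed.

Lemma on_block_cast (N : finType) (a : assembly N) (L L' : {set N})
    (T : finType) (u : bij T (sub L)) (u' : bij T (sub L')) :
    (forall x, val (u x) = val (u' x)) -> L = L' ->
  omap (bmap P u) (on_block a L) = omap (bmap P u') (on_block a L').
Proof.
move=> uu' eqL; case: L' / eqL u' uu' => u' uu'.
by congr (omap (bmap P _) _); apply: bij_ext => x; apply/val_inj.
Qed.

Lemma exp_map_id (N : finType) (a : assembly N) : exp_map (id_bij N) a = a.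
Proof.
apply: assembly_ext => L; rewrite on_block_exp_map.
rewrite (@on_block_cast _ a _ L _ _ (id_bij _)) ?imset_id //.
by case: (on_block a L) => //= p; rewrite bmap_id.
Qed.

Lemma exp_map_comp (N M L : finType) (v : bij M L) (w : bij N M) (a : assembly L) :
  exp_map (comp_bij v w) a = exp_map w (exp_map v a).
Proof.
apply: assembly_ext => K; rewrite !on_block_exp_map.
rewrite (@on_block_cast _ a _ (v @: (w @: K)) _ _
           (comp_bij (corestr v _) (corestr w K))) //; last exact: imset_comp.
by case: (on_block a _) => //= p; rewrite bmap_comp.
Qed.

Definition Exp : bspecies := BSpecies exp_map_id exp_map_comp.

Definition one_member_fun (N : finType) (p : P N) :
    {dffun forall L : {set N}, option (P (sub L))} :=
  [ffun L : {set N} => match @eqP _ L [set: N] with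
    | ReflectT e => Some (bmap P (incl_setT e) p)
    | ReflectF _ => None
    end].

Lemma one_member_subproof (N : finType) (p : P N) : (0 < #|N|)%N ->
  partition [set L | isSome (one_member_fun p L)] [set: N].
Proof.
move=> N_gt0.
have ->: [set L | isSome (one_member_fun p L)] = [set [set: N]].
  apply/setP=> L; rewrite !inE ffunE; by case: eqP.
rewrite /partition /cover big_set1 eqxx inE eq_sym -card_gt0 cardsT N_gt0 andbT.
by apply/trivIsetP => A B /set1P-> /set1P->; rewrite eqxx.
Qed.

Definition one_member (N : finType) (N_gt0 : (0 < #|N|)%N) (p : P N) : assembly N :=
  Sub (one_member_fun p) (one_member_subproof p N_gt0).

Definition empty_assembly_fun : {dffun forall L : {set void}, option (P (sub L))} :=
  [ffun L : {set void} => None].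

Lemma empty_assembly_subproof :
  partition [set L | isSome (empty_assembly_fun L)] [set: void].
Proof.
have ->: [set: void] = set0 by apply/setP=> -[].
set B := [set L | _]; have ->: B = set0.
  by apply/setP=> L; rewrite !inE ffunE.
by apply/and3P; rewrite /cover big_set0 /trivIset /cover !big_set0 cards0 inE.
Qed.

Definition empty_assembly : assembly void :=
  Sub empty_assembly_fun empty_assembly_subproof.

(* The assembly b on N is the union of the assemblies a_i on the subsets K_i:
   every member of some a_i is a member of b, and there are no others. *)
Definition is_union (N I : finType) (K : I -> {set N})
    (a : forall i, assembly (sub (K i))) (b : assembly N) : Prop :=
  (forall i (L : {set sub (K i)}), isSome (on_block (a i) L) ->
     omap (bmap P (corestr (incl (K i)) L)) (on_block b (incl (K i) @: L))
       = on_block (a i) L)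
  /\ (forall L : {set N}, isSome (on_block b L) ->
       exists i (L' : {set sub (K i)}),
         isSome (on_block (a i) L') /\ L = incl (K i) @: L').

End Assemblies.

Section Exponential.

Variables (E : rspecies) (P : bspecies).
(* Phi identifies assemblies of P-structures with E-structures. *)
Variable Phi : forall N : finType, Exp P N -> E N.

Definition exponential : Prop :=
  [/\ P void -> False,
      forall N, bijective (@Phi N)
    & forall (N M : finType) (w : bij N M) (a : Exp P M),
        Phi (bmap (Exp P) w a) = res E w (Phi a)].

(* u is the union of the assemblies s_i on the subsets K_i of N *)
Definition is_join (N I : finType) (K : I -> {set N})
    (s : forall i, E (sub (K i))) (u : E N) : Prop :=
  exists (a : forall i, Exp P (sub (K i))) (b : Exp P N),
    [/\ forall i, Phi (a i) = s i, Phi b = u & is_union a b].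

(* Below p_i|_{K :&: L_i} is the restriction of the assembly {p_i} along the
   inclusion of K :&: L_i, seen as a subset of K, into L_i. *)
Definition coherent : Prop :=
  forall (N : finType) (a : Exp P N) (K : {set N}),
    is_join (K := fun L : block a => incl K @^-1: val L)
      (fun L => res E (incl_cap K (val L))
                  (Phi (one_member (block_gt0 L) (member L))))
      (restr K (Phi a)).

(* u = s |_| t, where N is the disjoint union of K and its complement *)
Definition is_dunion (N : finType) (K : {set N})
    (s : E (sub K)) (t : E (sub (~: K))) (u : E N) : Prop :=
  is_join (K := fun b : bool => if b then K else ~: K)
    (fun b => if b return E (sub (if b then K else ~: K)) then s else t) u.

End Exponential.

Arguments exponential E P Phi : clear implicits.
Arguments coherent E P Phi : clear implicits.

Section ZQuot.

Variables (V : zmodType) (R : V -> Prop).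

Inductive zspan : V -> Prop :=
| zspan_gen x of R x : zspan x
| zspan0 : zspan 0
| zspanB x y of zspan x & zspan y : zspan (x - y).

Definition zspan_pred (x : V) : bool := `[< zspan x >].

Lemma zspan_zmod_closed : zmod_closed zspan_pred.
Proof.
split=> [|x y /asboolP Rx /asboolP Ry]; apply/asboolP; first exact: zspan0.
exact: zspanB.
Qed.

HB.instance Definition _ :=
  GRing.isZmodClosed.Build V zspan_pred zspan_zmod_closed.

Definition zspan_closed : zmodClosed V := GRing.ZmodClosed.clone V zspan_pred _.

Definition zquot : zmodType := {ideal_quot zspan_closed}.

Definition zpi (x : V) : zquot := \pi_{ideal_quot zspan_closed} x.

Definition zrepr (q : zquot) : V := generic_quotient.repr q.

Lemma zpi_is_zmod_morphism : zmod_morphism zpi.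
Proof. exact: (raddfB \pi_{ideal_quot zspan_closed}). Qed.

HB.instance Definition _ :=
  GRing.isZmodMorphism.Build V zquot zpi zpi_is_zmod_morphism.

Lemma zpiK (q : zquot) : zpi (zrepr q) = q.
Proof. exact: reprK. Qed.

Lemma zpi_eq (x y : V) : zpi x = zpi y <-> zspan (x - y).
Proof.
have e : zspan_pred (x - y) = (zpi x == zpi y).
  exact: (Quotient.idealrBE zspan_closed x y).
by split=> [/eqP|xy]; [rewrite -e => /asboolP | apply/eqP; rewrite -e; apply/asboolP].
Qed.

End ZQuot.

Definition zlift (T : choiceType) (V : zmodType) (f : T -> V) (d : {freeg T}) : V :=
  fglift (f : T -> zmodule V) d.

Lemma zliftB (T : choiceType) (V : zmodType) (f : T -> V) : zmod_morphism (zlift f).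
Proof. exact: (@lift_is_additive int T (zmodule V) f). Qed.

Lemma zliftU (T : choiceType) (V : zmodType) (f : T -> V) t : zlift f << t >> = f t.
Proof. by rewrite /zlift liftU; apply: mulr1z. Qed.

Section Tensor.

Variables V W : zmodType.

Inductive tensor_rel : {freeg (V * W)%type} -> Prop :=
| tensor_relDl v v' w : tensor_rel (<< (v + v', w) >> - << (v, w) >> - << (v', w) >>)
| tensor_relDr v w w' : tensor_rel (<< (v, w + w') >> - << (v, w) >> - << (v, w') >>).

Definition tensor : zmodType := zquot tensor_rel.

Definition tens (v : V) (w : W) : tensor := zpi tensor_rel << (v, w) >>.

Definition biadditive (U : zmodType) (f : V -> W -> U) : Prop :=
  (forall w, zmod_morphism (f^~ w)) /\ (forall v, zmod_morphism (f v)).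

(* The additive map with v (x) w |-> f v w; meaningful when f is biadditive,
   in which case the choice of a representative is irrelevant. *)
Definition tlift (U : zmodType) (f : V -> W -> U) (x : tensor) : U :=
  zlift (fun vw => f vw.1 vw.2) (zrepr x).

Lemma tlift_pi (U : zmodType) (f : V -> W -> U) d : biadditive f ->
  tlift f (zpi tensor_rel d) = zlift (fun vw => f vw.1 vw.2) d.
Proof.
case=> fl fr; pose g := zlift (fun vw => f vw.1 vw.2).
have gB : zmod_morphism g := @zliftB _ _ _.
have g0 : g 0 = 0 by have := gB 0 0; rewrite !subrr.
suff ker x : zspan tensor_rel x -> g x = 0.
  apply/eqP; rewrite -subr_eq0 -[zlift _ d]/(g d) -[tlift _ _]/(g _) -gB.
  by apply/eqP/ker/zpi_eq; rewrite zpiK.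
elim=> {x} [x Rx||x y _ gx _ gy]; rewrite ?gB ?gx ?gy ?subr0 //.
case: Rx => [v v' w|v w w']; rewrite !gB /g !zliftU /=.
  by rewrite -(fl w (v + v') v) addrAC subrr add0r subrr.
by rewrite -(fr v (w + w') w) addrAC subrr add0r subrr.
Qed.

Lemma tliftB (U : zmodType) (f : V -> W -> U) :
  biadditive f -> zmod_morphism (tlift f).
Proof.
by move=> fB x y; rewrite -[x]zpiK -[y]zpiK -raddfB !tlift_pi // zliftB.
Qed.

Lemma tliftE (U : zmodType) (f : V -> W -> U) v w :
  biadditive f -> tlift f (tens v w) = f v w.
Proof. by move=> fB; rewrite tlift_pi // zliftU. Qed.

End Tensor.

Section TensorMaps.

Variables A B C D : zmodType.

Definition tmap (f : A -> C) (g : B -> D) : tensor A B -> tensor C D :=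
  tlift (fun a b => tens (f a) (g b)).

Definition tassoc : tensor (tensor A B) C -> tensor A (tensor B C) :=
  tlift (fun ab c => tlift (fun a b => tens a (tens b c)) ab).

(* The product of the tensor square of an algebra: (a (x) b)(c (x) d) = ac (x) bd *)
Definition tmul (m : A -> A -> A) (x y : tensor A A) : tensor A A :=
  tlift (fun a b => tlift (fun c d => tens (m a c) (m b d)) y) x.

End TensorMaps.

(* A Hopf algebra structure on the abelian group V.  The antipode is unique,
   hence a property and not part of the data. *)
Record hopf (V : zmodType) := Hopf {
  hmul : V -> V -> V;
  hone : V;
  hcop : {additive V -> tensor V V};
  hcou : {additive V -> int};
  hmul_biadditive : biadditive hmul;
  hmulA : associative hmul;
  hmul1l : left_id hone hmul;
  hmul1r : right_id hone hmul;
  hcopA : forall x, tassoc (tmap hcop id (hcop x)) = tmap id hcop (hcop x);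
  hcop_coul : forall x, tlift (fun a b => b *~ hcou a) (hcop x) = x;
  hcop_cour : forall x, tlift (fun a b => a *~ hcou b) (hcop x) = x;
  hcopM : forall x y, hcop (hmul x y) = tmul hmul (hcop x) (hcop y);
  hcop1 : hcop hone = tens hone hone;
  hcouM : forall x y, hcou (hmul x y) = hcou x * hcou y;
  hcou1 : hcou hone = 1;
  hantipode : exists S : {additive V -> V}, forall x,
    tlift (fun a b => hmul (S a) b) (hcop x) = hone *~ hcou x
    /\ tlift (fun a b => hmul a (S b)) (hcop x) = hone *~ hcou x }.

(* Isomorphisms of bialgebras; these commute with the antipodes. *)
Definition hopf_isomorphic (V W : zmodType) (HV : hopf V) (HW : hopf W) : Prop :=
  exists f : {additive V -> W},
    [/\ bijective f,
        f (hone HV) = hone HW,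
        forall x y, f (hmul HV x y) = hmul HW (f x) (f y),
        forall x, hcop HW (f x) = tmap f f (hcop HV x)
      & forall x, hcou HW (f x) = hcou HV x].

Section SpeciesHopf.

Variable E : rspecies.

Definition iso_rel (s t : {n : nat & E 'I_n}) : bool :=
  `[< exists w : bij 'I_(tag s) 'I_(tag t), res E w (tagged t) = tagged s >].

Lemma iso_rel_equiv : equiv_class_of iso_rel.
Proof.
have sym s t : iso_rel s t -> iso_rel t s.
  case: s t => n s [m t] /asboolP[/= w <-]; apply/asboolP => /=.
  have [g wK gK] := bij_bij w.
  exists (@Bij _ _ (Inj (can_inj gK)) (Bijective gK wK)); rewrite -res_comp.
  rewrite (_ : comp_inj _ _ = id_inj _) ?res_id //.
  by apply: inj_ext => x /=; rewrite gK.
split=> [[n s]|s t|t s u].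
- by apply/asboolP; exists (id_bij _); rewrite res_id.
- by apply/idP/idP; apply: sym.
- case: s t u => n s [m t] [l u] /asboolP[/= w <-] /asboolP[/= v <-].
  by apply/asboolP; exists (comp_bij v w); rewrite res_comp.
Qed.

Canonical iso_equiv := EquivRelPack iso_rel_equiv.
Canonical iso_encModRel := defaultEncModRel iso_rel.

Definition iso_class : choiceType := {eq_quot iso_rel}.

Definition iso_class_of (N : finType) (s : E N) : iso_class :=
  \pi_{eq_quot iso_rel} (existT (fun n => E 'I_n) #|N| (res E (std N) s)).

Definition BE : zmodType := {freeg iso_class}.

(* [s] *)
Definition bcls (N : finType) (s : E N) : BE := << iso_class_of s >>.

Variables (P : bspecies) (Phi : forall N : finType, Exp P N -> E N).

(* H is the structure of the Hopf algebra B_E: these formulas determine the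
   product, the unit, the coproduct and the counit. *)
Definition is_BE (H : hopf BE) : Prop :=
  [/\ forall (N : finType) (K : {set N}) (s : E (sub K)) (t : E (sub (~: K)))
        (u : E N), is_dunion Phi s t u ->
        hmul H (bcls s) (bcls t) = bcls u,
      hone H = bcls (Phi (empty_assembly P)),
      forall (N : finType) (s : E N),
        hcop H (bcls s) =
          \sum_(K : {set N}) tens (bcls (restr K s)) (bcls (restr (~: K) s))
    & forall (N : finType) (s : E N),
        hcou H (bcls s) = (bcls s == hone H)%:R].

End SpeciesHopf.

Arguments is_BE E P Phi H : clear implicits.

Section FunSpecies.

Variables (k : closedFieldType) (gT : finGroupType) (H : {group gT}).
(* An irrType indexes a set of representatives [irr_repr] of the isomorphism
   classes of irreducible representations of H over k, as char k = 0. *)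
Variable Hhat : irrType k H.
Variable Y : youngSet.

Definition fun_res (N M : finType) (w : inj N M) (F : {ffun Y M -> Hhat}) :
    {ffun Y N -> Hhat} :=
  [ffun y => F (Ymap Y w y)].

Lemma fun_res_id (N : finType) (F : {ffun Y N -> Hhat}) : fun_res (id_inj N) F = F.
Proof. by apply/ffunP=> y; rewrite ffunE Ymap_id. Qed.

Lemma fun_res_comp (N M L : finType) (v : inj M L) (w : inj N M)
  (F : {ffun Y L -> Hhat}) : fun_res (comp_inj v w) F = fun_res w (fun_res v F).
Proof. by apply/ffunP=> y; rewrite !ffunE Ymap_comp. Qed.

Definition fun_species : rspecies := RSpecies fun_res_id fun_res_comp.

Definition triv : Hhat := [1 Hhat]%irr.

Definition supp (N : finType) (F : fun_species N) : {set Y N} :=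
  [set y | F y != triv].

Definition primitive (N : finType) (F : fun_species N) : bool :=
  (0 < #|N|)%N &&
  [forall K : {set N}, (K != set0) && (K \proper [set: N]) ==>
     ~~ (supp F \subset Ysub Y K :|: Ysub Y (~: K))].

Lemma Ysub_imset (N M : finType) (w : inj N M) (K : {set N}) (y : Y N) :
  y \in Ysub Y K -> Ymap Y w y \in Ysub Y (w @: K).
Proof.
case/imsetP=> z _ ->; apply/imsetP; exists (Ymap Y (corestr w K) z) => //.
by rewrite -!Ymap_comp; congr (Ymap Y _ z); apply: inj_ext.
Qed.

Lemma primitive_res (N M : finType) (w : bij N M) (F : fun_species M) :
  primitive F -> primitive (res fun_species w F).
Proof.
case/andP=> M_gt0 /forallP primF; have [g wK gK] := bij_bij w.
rewrite /primitive (bij_eq_card (bij_bij w)) M_gt0.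
apply/forallP=> K; apply/implyP=> /andP[K0 KT].
have wC : w @: (~: K) = ~: (w @: K).
  apply/setP=> x; rewrite inE -[x in LHS]gK -[x in RHS]gK !mem_imset ?inE //;
  exact: inj_inj.
have /implyP/(_ _)/subsetPn[] := primF (w @: K).
  move: K0 KT; rewrite -!card_gt0 !properEcard !subsetT !cardsT card_imset.
    by move=> -> /=; rewrite (bij_eq_card (bij_bij w)).
  exact: inj_inj.
move=> y; rewrite inE => Fy ny; apply/subsetPn.
pose w' : inj M N := Inj (can_inj gK).
have y_w : y = Ymap Y w (Ymap Y w' y).
  rewrite -Ymap_comp -[LHS]Ymap_id; congr (Ymap Y _ y).
  by apply: inj_ext => x /=; rewrite gK.
exists (Ymap Y w' y); first by rewrite inE ffunE -y_w.
apply: contra ny; rewrite !inE => /orP[] /(Ysub_imset w); rewrite -y_w.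
  by move=> ->.
by rewrite wC => ->; rewrite orbT.
Qed.

Definition prim_ob (N : finType) : finType := {F : fun_species N | primitive F}.

Definition prim_map (N M : finType) (w : bij N M) (F : prim_ob M) : prim_ob N :=
  exist _ (res fun_species w (val F)) (primitive_res w (valP F)).

Lemma prim_map_id (N : finType) (F : prim_ob N) : prim_map (id_bij N) F = F.
Proof. by apply/val_inj; apply: (res_id (r := fun_species)). Qed.

Lemma prim_map_comp (N M L : finType) (v : bij M L) (w : bij N M) (F : prim_ob L) :
  prim_map (comp_bij v w) F = prim_map w (prim_map v F).
Proof. by apply/val_inj; apply: (res_comp (r := fun_species)). Qed.

Definition prim_species : bspecies := BSpecies prim_map_id prim_map_comp.

(* {F_i} |-> |_|_i F_i: the value at y is F_i(z) if y comes from z in Y_(L_i)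
   for some block L_i, and triv elsewhere. *)
Definition assemble (N : finType) (a : Exp prim_species N) : fun_species N :=
  [ffun y => if [pick u : {L : block a & Y (sub (val L))}
                  | Ymap Y (incl (val (tag u))) (tagged u) == y] is Some u
             then val (member (tag u)) (tagged u) else triv].

(* F_K |_| F_L for L the complement of K *)
Definition fun_dunion (N : finType) (K : {set N})
    (F : fun_species (sub K)) (G : fun_species (sub (~: K))) : fun_species N :=
  [ffun y => if [pick z | Ymap Y (incl K) z == y] is Some z then F z
             else if [pick z | Ymap Y (incl (~: K)) z == y] is Some z then G z
             else triv].

(* Fun(Y_N, H) with the pointwise product *)
Definition fun_group (N : finType) : {group {dffun forall _ : Y N, gT}} :=
  setXn_group (fun _ : Y N => H).

(* Finite-dimensional representations of Fun(Y_N, H) for N = 'I_n *)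
Definition fun_rep : Type :=
  {n : nat & {d : nat & mx_representation k (fun_group 'I_n) d}}.

Definition FunRep (n d : nat) (V : mx_representation k (fun_group 'I_n) d) : {classic fun_rep} :=
  existT (fun n => {d : nat & mx_representation k (fun_group 'I_n) d}) n
    (existT (fun d => mx_representation k (fun_group 'I_n) d) d V).

(* The relations of the Grothendieck groups, [V] = [V'] + [V''] for each short
   exact sequence 0 -> V' -> V -> V'' -> 0 (matrices act on row vectors), and
   of the coinvariants: [V] = [w V], where (w V)(f) = V(f \o Y_w). *)
Inductive BYH_rel : {freeg {classic fun_rep}} -> Prop :=
| BYH_exact n d d' d'' (V : mx_representation k (fun_group 'I_n) d)
    (V' : mx_representation k (fun_group 'I_n) d')
    (V'' : mx_representation k (fun_group 'I_n) d'')
    (i : 'M[k]_(d', d)) (p : 'M[k]_(d, d'')) of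
    {in fun_group 'I_n, forall f, V' f *m i = i *m V f} &
    {in fun_group 'I_n, forall f, V f *m p = p *m V'' f} &
    row_free i & row_full p & (i :=: kermx p)%MS :
    BYH_rel (<< FunRep V >> - << FunRep V' >> - << FunRep V'' >>)
| BYH_transport n m (w : bij 'I_n 'I_m) d
    (V : mx_representation k (fun_group 'I_n) d)
    (wV : mx_representation k (fun_group 'I_m) d) of
    {in fun_group 'I_m, forall f,
       wV f = V ([ffun y => f (Ymap Y w y)] : {dffun forall _ : Y 'I_n, gT})} :
    BYH_rel (<< FunRep V >> - << FunRep wV >>).

(* The direct sum over N of the Grothendieck groups R(Fun(Y_N, H)), modulo
   transport along bijections *)
Definition BYH : zmodType := zquot BYH_rel.

Section Pi.

Hypothesis abH : abelian H.

(* The representation f |-> (x)_y F(y)(f(y)).  As H is abelian and k is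
   algebraically closed, the F(y) are one-dimensional and their tensor product
   is the product of the scalars by which they act. *)
Definition pi_fun (N : finType) (F : fun_species N)
    (f : {dffun forall _ : Y N, gT}) : 'M[k]_1 :=
  (\prod_(y : Y N) irr_mode (F y) (f y))%:M.

Lemma pi_fun_repr (N : finType) (F : fun_species N) :
  mx_repr (fun_group N) (pi_fun F).
Proof.
split=> [|f g /setXnP Hf /setXnP Hg]; rewrite /pi_fun.
  by rewrite big1 // => y _; rewrite ffunE irr_mode1.
rewrite -scalar_mxM -big_split; congr _%:M; apply: eq_bigr => y _.
rewrite ffunE irr_modeM ?(center_idP abH) //.
exact: group_closure_closed_field.
Qed.

Definition pi_rep (N : finType) (F : fun_species N) :
    mx_representation k (fun_group N) 1 :=
  MxRepresentation (pi_fun_repr F).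

Definition pi_cls (N : finType) (F : fun_species N) : BYH :=
  zpi BYH_rel << FunRep (pi_rep (res fun_species (std N) F)) >>.

(* A is the structure of the Hopf algebra B^Delta_(Y, H): the classes pi_F
   generate BYH, so that these formulas determine the product, the unit, the
   coproduct and the counit. *)
Definition is_BYH (A : hopf BYH) : Prop :=
  [/\ forall (N : finType) (K : {set N}) (F : fun_species (sub K))
        (G : fun_species (sub (~: K))),
        hmul A (pi_cls F) (pi_cls G) = pi_cls (fun_dunion F G),
      forall F : fun_species void, hone A = pi_cls F,
      forall (N : finType) (F : fun_species N),
        hcop A (pi_cls F) =
          \sum_(K : {set N}) tens (pi_cls (restr K F)) (pi_cls (restr (~: K) F))
    & forall (N : finType) (F : fun_species N),
        hcou A (pi_cls F) = (pi_cls F == hone A)%:R].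

End Pi.

End FunSpecies.

Arguments assemble [k gT H] Hhat Y N a.

(* Main.v *)
Require Import Defs.
From HB Require Import structures.
From mathcomp Require Import all_boot all_order all_algebra.
From mathcomp Require Import all_fingroup all_solvable all_character.
From mathcomp Require Import boolp freeg.

Set Implicit Arguments.
Unset Strict Implicit.
Unset Printing Implicit Defensive.

Import Defs GRing.Theory.
Local Open Scope ring_scope.
Local Open Scope quotient_scope.

(** Fix F in Fun(Y_N, Hhat) and say that K splits F if supp F lies in the union
of Y_K and Y_(N - K).  As Y_K and Y_L meet in Y_(K :&: L), the sets that split
F form a Boolean algebra of subsets of N; its atoms partition N.  The
restriction of F to an atom L is primitive, because a set that splits F|_L also
splits F.  A point of supp F lies in Y_L for some atom L, since otherwise it
would lie in Y_(N - L) for all L, hence in Y of the empty set, which is empty.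
So F is the union of its restrictions to its atoms ([atomsK]), and if F is the
union of an assembly of primitive functions, then the blocks are atoms of F
([atom_assemble]), whence uniqueness ([assembleK]).  Both parts of this
description are compatible with restriction: if disjoint sets K_i cover N and
supp F lies in the union of the Y_(K_i), then the atoms of F are those of the
F|_(K_i).  This characterizes unions of assemblies ([is_joinP]) and yields
coherence.

For the second assertion, both groups turn out to be free on the isomorphism
classes of functions, and the structure maps have the same values on these
bases.  For B_E freeness is the definition.  For B^Delta it follows from
representation theory: Fun(Y_N, H) is a finite abelian group and k is
algebraically closed of characteristic 0, so the pi_F are its linear
characters, each of them once, and the multiplicity of pi_F in a representation
V is the rank of the operator sum_f pi_F(f^-1) V(f).  This rank is additive in
short exact sequences ([mult_exact]) and compatible with transport, so that the
multiplicities are coordinates on B^Delta ([BYH_coord]); conversely every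
representation of positive dimension contains some pi_F, and by induction its
class is the sum of the pi_F with these multiplicities ([BYH_coordK]).

That the formulas on the basis define a Hopf algebra is checked once, for any
group identified with the free group on the classes ([cls_hopf_exists]).  The
product of the classes of F and G is the class of their disjoint union on a
sum type, and all the axioms become identities between the classes [F|_A] of
the restrictions of one function F on N to subsets A of N, proved with the two
rules
   [F|_A] = [F|_(A :&: K)] [F|_(A - K)]  if K splits F,
   Delta [F|_A] = sum over B in A of [F|_B] (x) [F|_(A - B)].
The antipode is defined by recursion on A; it is two-sided because the product
is commutative and the coproduct cocommutative.  Two Hopf algebras with the
same formulas on corresponding bases are isomorphic
([cls_hopf_isomorphic]). *)


(** * Subsets of a Young set *)

Lemma incl_imsetT (N : finType) (K : {set N}) : incl K @: setT = K.
Proof.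
apply/setP=> x; apply/imsetP/idP => [[z _ ->]|xL]; first exact: (valP z).
by exists (exist _ x xL).
Qed.

Section YoungSubsets.

Variable Y : youngSet.

Lemma Ymap_eq (N M : finType) (v w : inj N M) (y : Y N) :
  v =1 w -> Ymap Y v y = Ymap Y w y.
Proof. by move=> /inj_ext->. Qed.

Lemma mem_Ysub_factor (N M : finType) (w : inj M N) (L : {set N}) z :
  (forall x, w x \in L) -> Ymap Y w z \in Ysub Y L.
Proof.
move=> wL; pose v x : sub L := exist _ (w x) (wL x).
have v_inj : injective v by move=> x x' /(congr1 val) /= /inj_inj.
apply/imsetP; exists (Ymap Y (Inj v_inj) z) => //.
by rewrite -Ymap_comp; apply: Ymap_eq.
Qed.

Lemma Ysub_mono (N : finType) (K L : {set N}) (y : Y N) :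
  K \subset L -> y \in Ysub Y K -> y \in Ysub Y L.
Proof.
move=> /subsetP KL /imsetP[z _ ->]; apply: mem_Ysub_factor => x.
exact/KL/(valP x).
Qed.

Lemma Ysub_cap (N : finType) (K L : {set N}) (y : Y N) :
  y \in Ysub Y K -> y \in Ysub Y L -> y \in Ysub Y (K :&: L).
Proof. by move=> yK yL; rewrite /Ysub -Ycap inE yK. Qed.

Lemma Y_nonempty (N : finType) (y : Y N) : (0 < #|N|)%N.
Proof.
rewrite lt0n; apply/negP=> /eqP/card0_eq N0.
pose f (x : N) : void := False_rect void (notF (esym (N0 x))).
have f_inj : injective f by move=> x; have := N0 x.
exact: (Yvoid (Ymap Y (Inj f_inj) y)).
Qed.

Lemma Ysub0 (N : finType) (y : Y N) : y \notin Ysub Y set0.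
Proof.
by apply/negP=> /imsetP[z _ _]; have := Y_nonempty z; rewrite card_sig cards0.
Qed.

Lemma Ysub_disjoint (N : finType) (K L : {set N}) (y : Y N) :
  [disjoint K & L] -> y \in Ysub Y K -> y \in Ysub Y L -> False.
Proof.
move=> /disjoint_setI0 KL yK yL; have := Ysub_cap yK yL.
by rewrite KL (negPf (Ysub0 _)).
Qed.

Lemma mem_Ysub_im (N M : finType) (w : inj M N) z :
  Ymap Y w z \in Ysub Y (w @: setT).
Proof. by apply: mem_Ysub_factor => x; rewrite imset_f. Qed.

Lemma Ysub_imP (N M : finType) (w : inj M N) (y : Y N) :
  y \in Ysub Y (w @: setT) -> exists z, y = Ymap Y w z.
Proof.
case/imsetP=> z _ ->; have [h hK Kh] := corestr_bij w setT.
exists (Ymap Y (comp_inj (incl setT) (Inj (can_inj Kh))) z).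
rewrite -Ymap_comp; apply: Ymap_eq => x /=.
by rewrite -[x in LHS]Kh.
Qed.

Lemma YsubT (N : finType) (y : Y N) : y \in Ysub Y setT.
Proof. by have := mem_Ysub_im (id_inj N) y; rewrite Ymap_id imset_id. Qed.

(** If the image under w of y in Y_M comes from Y_(w K), then it also comes from
    Y_K through w, and Y_w is injective. *)
Lemma Ysub_map (N M : finType) (w : inj M N) (K : {set M}) z :
  (Ymap Y w z \in Ysub Y (w @: K)) = (z \in Ysub Y K).
Proof.
apply/idP/idP => [|/imsetP[x _ ->]]; last first.
  by rewrite -Ymap_comp; apply: mem_Ysub_factor => t; apply/imset_f/(valP t).
have -> : w @: K = comp_inj w (incl K) @: setT.
  apply/setP=> x; apply/imsetP/imsetP => [[t tK ->]|[t _ ->]].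
    by exists (exist _ t tK).
  by exists (val t) => //; apply: valP.
case/Ysub_imP=> t; rewrite Ymap_comp => /inj_inj ->.
exact: imset_f.
Qed.

(** The image of Y_w is Y_(w M), so that a point of it that lies in Y_L lies in
    the intersection, which is Y of the image of the preimage of L. *)
Lemma Ysub_preim (N M : finType) (w : inj M N) (L : {set N}) z :
  (Ymap Y w z \in Ysub Y L) = (z \in Ysub Y (w @^-1: L)).
Proof.
rewrite -(Ysub_map w); apply/idP/idP => [zL|]; last first.
  by apply: Ysub_mono; apply/subsetP=> x /imsetP[t]; rewrite inE => tL ->.
apply: Ysub_mono (Ysub_cap zL (mem_Ysub_im w z)).
apply/subsetP=> x /setIP[xL /imsetP[t _ xt]]; rewrite xt imset_f // inE -xt //.
Qed.

End YoungSubsets.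

(** * Splitting sets and their atoms *)

Section Atoms.

Variables (k : closedFieldType) (gT : finGroupType) (H : {group gT}).
Variables (Hhat : irrType k H) (Y : youngSet).

Local Notation E := (fun_species Hhat Y).
Local Notation P := (prim_species Hhat Y).
Local Notation Phi := (assemble Hhat Y).
Local Notation asm := (assemble Hhat Y _).

Lemma resE (N M : finType) (w : inj N M) (F : E M) y :
  res E w F y = F (Ymap Y w y).
Proof. by rewrite ffunE. Qed.

Lemma res_eq (N M : finType) (v w : inj N M) (F : E M) :
  v =1 w -> res E v F = res E w F.
Proof. by move=> /inj_ext->. Qed.

Lemma mem_supp (N : finType) (F : E N) y : (y \in supp F) = (F y != triv Hhat).
Proof. by rewrite inE. Qed.

Definition splits (N : finType) (F : E N) (K : {set N}) : bool :=
  supp F \subset Ysub Y K :|: Ysub Y (~: K).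

Lemma splitsP (N : finType) (F : E N) (K : {set N}) :
  reflect (forall y, y \in supp F -> y \in Ysub Y K \/ y \in Ysub Y (~: K))
          (splits F K).
Proof.
apply: (iffP subsetP) => sF y /sF; first by case/setUP; [left | right].
by case=> yK; rewrite inE yK ?orbT.
Qed.

Lemma splitsC (N : finType) (F : E N) (K : {set N}) :
  splits F (~: K) = splits F K.
Proof. by rewrite /splits setCK setUC. Qed.

Lemma splitsT (N : finType) (F : E N) : splits F setT.
Proof. by apply/splitsP=> y _; left; apply: YsubT. Qed.

Lemma splits0 (N : finType) (F : E N) : splits F set0.
Proof. by rewrite -splitsC setC0 splitsT. Qed.

(** This is where Y_K and Y_L meeting in Y_(K :&: L) makes the splitting sets a
    Boolean algebra. *)
Lemma splitsI (N : finType) (F : E N) (K L : {set N}) :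
  splits F K -> splits F L -> splits F (K :&: L).
Proof.
move=> /splitsP FK /splitsP FL; apply/splitsP=> y Fy; rewrite setCI.
case: (FK y Fy) => yK; last by right; apply: Ysub_mono yK; apply: subsetUl.
case: (FL y Fy) => yL; last by right; apply: Ysub_mono yL; apply: subsetUr.
by left; apply: Ysub_cap.
Qed.

Lemma splits_res (N M : finType) (w : inj N M) (F : E M) (K : {set M}) :
  splits F K -> splits (res E w F) (w @^-1: K).
Proof.
move=> /splitsP FK; apply/splitsP=> y; rewrite mem_supp resE -mem_supp => /FK.
by rewrite !Ysub_preim preimsetC.
Qed.

(** The points of supp F that do not come from the image of w come from its
    complement, hence from the complement of w K. *)
Lemma splits_ext (N M : finType) (w : inj N M) (F : E M) (K : {set N}) :
  splits F (w @: setT) -> splits (res E w F) K -> splits F (w @: K).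
Proof.
move=> /splitsP FT /splitsP FK; apply/splitsP=> y Fy.
case: (FT y Fy) => [/Ysub_imP[z yz]|]; last first.
  by move=> yT; right; apply: Ysub_mono yT; rewrite setCS imsetS.
have /FK: z \in supp (res E w F) by rewrite mem_supp resE -yz -mem_supp.
rewrite yz Ysub_map => -[|zK]; [by left | right].
rewrite Ysub_preim; apply: Ysub_mono zK; apply/subsetP=> x.
by rewrite !inE mem_imset //; apply: inj_inj.
Qed.

(** The atoms of the Boolean algebra of splitting sets; the condition on K is
    that no splitting set cuts L. *)
Definition atom (N : finType) (F : E N) (L : {set N}) : bool :=
  [&& L != set0, splits F L
    & [forall K, splits F K ==> [disjoint L & K] || (L \subset K)]].

Lemma atomP (N : finType) (F : E N) (L : {set N}) :
  reflect [/\ L != set0, splits F L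
            & forall K, splits F K -> [disjoint L & K] || (L \subset K)]
          (atom F L).
Proof.
apply: (iffP and3P) => -[L0 FL].
  by move/forallP=> FK; split=> // K; apply/implyP.
by move=> FK; split=> //; apply/forallP=> K; apply/implyP/FK.
Qed.

Lemma atom_exists (N : finType) (F : E N) (x : N) : exists2 L, atom F L & x \in L.
Proof.
pose L := \bigcap_(K : {set N} | splits F K && (x \in K)) K.
have xL : x \in L by apply/bigcapP=> K /andP[].
exists L => //; apply/atomP; split.
- by apply/set0Pn; exists x.
- apply: (big_ind (fun K => splits F K)); first exact: splitsT.
    by move=> K K'; apply: splitsI.
  by move=> K /andP[].
- move=> K FK; case: (boolP (x \in K)) => xK.
    by rewrite orbC (bigcap_inf K) ?FK.
  by rewrite disjoints_subset (bigcap_inf (~: K)) // splitsC FK inE.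
Qed.

Lemma atom_meet (N : finType) (F : E N) (L L' : {set N}) :
  atom F L -> atom F L' -> ~~ [disjoint L & L'] -> L = L'.
Proof.
move=> /atomP[_ FL mL] /atomP[_ FL' mL'] dis; apply/eqP; rewrite eqEsubset.
have := mL _ FL'; have := mL' _ FL.
by rewrite disjoint_sym (negPf dis) /= => -> ->.
Qed.

Lemma atoms_partition (N : finType) (F : E N) :
  partition [set L | atom F L] [set: N].
Proof.
apply/and3P; split.
- apply/eqP/setP=> x; rewrite inE; apply/bigcupP.
  by have [L FL xL] := atom_exists F x; exists L; rewrite ?inE.
- apply/trivIsetP=> A B; rewrite !inE => FA FB; apply: contraR => dis.
  exact/eqP/(atom_meet FA FB).
- by rewrite inE; apply/atomP=> -[]; rewrite eqxx.
Qed.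

(** Otherwise y would lie in Y_(N - L) for all the atoms L, and the intersection
    of these complements is empty. *)
Lemma supp_atom (N : finType) (F : E N) y :
  y \in supp F -> exists2 L, atom F L & y \in Ysub Y L.
Proof.
move=> Fy; case: (pickP (fun L => atom F L && (y \in Ysub Y L))).
  by move=> L /andP[? ?]; exists L.
move=> no; exfalso.
have: y \in Ysub Y (\bigcap_(L : {set N} | atom F L) ~: L).
  apply: (big_ind (fun K => y \in Ysub Y K)); first exact: YsubT.
    by move=> K L; apply: Ysub_cap.
  move=> L FL; have /atomP[_ /splitsP/(_ y Fy)[yL|//] _] := FL.
  by have := no L; rewrite FL yL.
rewrite (_ : \bigcap_(L | _) _ = set0) ?(negPf (Ysub0 _)) //.
apply/setP=> x; rewrite inE; apply/negP=> /bigcapP xL.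
by have [L FL] := atom_exists F x; have := xL L FL; rewrite inE => /negP.
Qed.

Lemma restr_imset (N M : finType) (w : inj N M) (F : E M) (L : {set N}) :
  restr L (res E w F) = res E (corestr w L) (restr (w @: L) F).
Proof. by rewrite /restr -!res_comp; apply: res_eq. Qed.

(** Taking images and preimages along w exchanges the splitting sets of the
    restriction with those of F, up to intersection with the image of w. *)
Lemma atom_ext (N M : finType) (w : inj N M) (F : E M) (L : {set N}) :
  splits F (w @: setT) -> atom (res E w F) L = atom F (w @: L).
Proof.
move=> FT; have wI := @inj_inj _ _ w.
have wK (K : {set N}) : w @^-1: (w @: K) = K.
  by apply/setP=> x; rewrite inE mem_imset.
apply/atomP/atomP => -[L0 FL mL]; split.
- by rewrite -card_gt0 card_imset // card_gt0.
- exact: splits_ext.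
- move=> K /(splits_res w)/mL/orP[].
    rewrite -!setI_eq0 => /eqP LK; apply/orP; left; apply/eqP/setP=> x.
    rewrite !inE; apply/negP=> /andP[/imsetP[z zL ->] zK].
    by have /setP/(_ z) := LK; rewrite !inE zL zK.
  rewrite -sub_imset_pre => ->; exact: orbT.
- by move: L0; rewrite -!card_gt0 card_imset.
- by rewrite -(wK L) splits_res.
- move=> K FK; have /mL/orP[] : splits F (w @: K) by apply: splits_ext.
    by rewrite -!setI_eq0 -imsetI; [rewrite imset_eq0 => -> | move=> ? ? _ _ /wI].
  by move=> /(preimsetS w); rewrite !wK orbC => ->.
Qed.

(** For N nonempty, both sides say that only the empty set and N split F. *)
Lemma primitive_atom (N : finType) (F : E N) : primitive F = atom F setT.
Proof.
rewrite /primitive /atom -cardsT card_gt0 splitsT /=.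
case: (_ != set0) => //=.
apply/forallP/forallP => FK K; have := FK K; rewrite -/(splits F K) -setI_eq0 setTI.
  rewrite subTset properT; case: (splits F K) (K == set0) (K == setT) => -[] [] //.
rewrite subTset properT; case: (splits F K) (K == set0) (K == setT) => -[] [] //.
Qed.

Lemma primitive_restr (N : finType) (F : E N) (L : {set N}) :
  splits F L -> primitive (restr L F) = atom F L.
Proof.
by move=> FL; rewrite primitive_atom atom_ext incl_imsetT.
Qed.


(** * Functions as assemblies of primitive functions *)

Lemma on_block_meet (N : finType) (a : assembly P N) (L L' : {set N}) :
  isSome (on_block a L) -> isSome (on_block a L') -> ~~ [disjoint L & L'] ->
  L = L'.
Proof.
move=> aL aL' dis; case/and3P: (valP a) => _ /trivIsetP tri _.
apply/eqP; apply: contraR dis; apply: tri; rewrite inE //.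
Qed.

Lemma on_block_cover (N : finType) (a : assembly P N) (x : N) :
  exists2 L, isSome (on_block a L) & x \in L.
Proof.
case/and3P: (valP a) => /eqP cov _ _.
have: x \in [set: N] by []. 
by rewrite -cov => /bigcupP[L]; rewrite inE => aL xL; exists L.
Qed.

Lemma on_block_member (N : finType) (a : assembly P N) (L : block a) :
  on_block a (val L) = Some (member L).
Proof. by rewrite /member; case: (on_block a _) (valP L). Qed.

Lemma on_block_Ysub_meet (N : finType) (a : assembly P N) (L L' : {set N}) y :
  isSome (on_block a L) -> isSome (on_block a L') ->
  y \in Ysub Y L -> y \in Ysub Y L' -> L = L'.
Proof.
move=> aL aL' yL yL'; apply: (on_block_meet aL aL'); apply/negP=> dis.
exact: Ysub_disjoint dis yL yL'.
Qed.

Lemma assemble_on (N : finType) (a : assembly P N) (L : {set N}) p z :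
  on_block a L = Some p -> asm a (Ymap Y (incl L) z) = val p z.
Proof.
move=> aL; rewrite ffunE; case: pickP => [[K t] /= /eqP tz|none]; last first.
  have hL : isSome (on_block a L) by rewrite aL.
  by have /eqP := none (existT (fun K : block a => Y (sub (val K))) (exist _ L hL) z).
have KL : val K = L.
  apply: (@on_block_Ysub_meet _ a _ _ (Ymap Y (incl L) z)).
  - exact: (valP K).
  - by rewrite aL.
  - by rewrite -tz imset_f.
  - exact: imset_f.
case: L / KL p z aL tz => p z; rewrite on_block_member => -[<-].
by move=> /inj_inj->.
Qed.

Lemma assemble_off (N : finType) (a : assembly P N) y :
  (forall L, isSome (on_block a L) -> y \notin Ysub Y L) -> asm a y = triv Hhat.
Proof.
move=> off; rewrite ffunE; case: pickP => [[K t] /= /eqP ty|//].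
by have := off _ (valP K); rewrite -ty imset_f.
Qed.

Lemma restr_assemble (N : finType) (a : assembly P N) (L : {set N}) p :
  on_block a L = Some p -> restr L (asm a) = val p.
Proof. by move=> aL; apply/ffunP=> z; rewrite resE; apply: assemble_on. Qed.

(** A point outside of all the Y_L, for L a block, is mapped to the trivial
    representation, and two blocks are equal or disjoint. *)
Lemma splits_assemble (N : finType) (a : assembly P N) (L : {set N}) :
  isSome (on_block a L) -> splits (asm a) L.
Proof.
move=> aL; apply/splitsP=> y; rewrite mem_supp => ay.
have [[K aK yK]|off] := pselect (exists2 K, isSome (on_block a K) & y \in Ysub Y K).
  have [/disjoint_setI0 LK|] := boolP [disjoint K & L].
    by right; apply: Ysub_mono yK; rewrite -disjoints_subset -setI_eq0 LK.
  by move/(on_block_meet aK aL)=> <-; left.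
case/eqP: ay; apply: assemble_off => K aK; apply/negP=> yK.
by apply: off; exists K.
Qed.

(** The blocks are atoms, because their structures are primitive; as they cover
    N and atoms are equal or disjoint, there are no other atoms. *)
Lemma atom_assemble (N : finType) (a : assembly P N) (L : {set N}) :
  atom (asm a) L = isSome (on_block a L).
Proof.
have sub_atom K : isSome (on_block a K) -> atom (asm a) K.
  move=> aK; rewrite -primitive_restr; last exact: splits_assemble.
  by case aKp: (on_block a K) aK => [p|//] _; rewrite (restr_assemble aKp) (valP p).
apply/idP/idP => [FL|/sub_atom//]; have /atomP[/set0Pn[x xL] _ _] := FL.
have [K aK xK] := on_block_cover a x.
rewrite (atom_meet FL (sub_atom K aK)) //.
by apply/negP=> /disjoint_setI0/setP/(_ x); rewrite !inE xL xK.
Qed.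

Definition atoms_fun (N : finType) (F : E N) :
    {dffun forall L : {set N}, option (P (sub L))} :=
  [ffun L => if atom F L then insub (restr L F) else None].

Lemma isSome_atoms (N : finType) (F : E N) (L : {set N}) :
  isSome (atoms_fun F L) = atom F L.
Proof.
rewrite ffunE; case: ifP => // FL; rewrite insubT //.
by rewrite primitive_restr //; case/atomP: FL.
Qed.

Lemma atoms_subproof (N : finType) (F : E N) :
  partition [set L | isSome (atoms_fun F L)] [set: N].
Proof.
rewrite (_ : [set L | _] = [set L | atom F L]) ?atoms_partition //.
by apply/setP=> L; rewrite !inE isSome_atoms.
Qed.

Definition atoms (N : finType) (F : E N) : Exp P N :=
  Sub (atoms_fun F) (atoms_subproof F).

Lemma on_block_atoms (N : finType) (F : E N) (L : {set N}) :
  on_block (atoms F) L = if atom F L then insub (restr L F) else None.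
Proof. by rewrite /on_block /= ffunE. Qed.

Lemma isSome_on_block_atoms (N : finType) (F : E N) (L : {set N}) :
  isSome (on_block (atoms F) L) = atom F L.
Proof. exact: isSome_atoms. Qed.

Lemma assembleK (N : finType) : cancel (Phi N) (@atoms N).
Proof.
move=> a; apply: assembly_ext => L; rewrite on_block_atoms atom_assemble.
case aL: (on_block a L) => [p|//].
by rewrite (restr_assemble aL); apply: valK.
Qed.

Lemma atomsK (N : finType) : cancel (@atoms N) (Phi N).
Proof.
move=> F; apply/ffunP=> y.
have [[K aK /imsetP[z _ ->]]|off] :=
    pselect (exists2 K, atom F K & y \in Ysub Y K).
  have FK : primitive (restr K F) by rewrite primitive_restr //; case/atomP: aK.
  rewrite (@assemble_on _ _ _ (exist _ (restr K F) FK)) ?resE //.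
  by rewrite on_block_atoms aK (insubT (@primitive _ _ _ _ _ _)).
rewrite assemble_off => [|L]; last first.
  by rewrite isSome_on_block_atoms => FL; apply/negP=> yL; apply: off; exists L.
apply/eqP; rewrite eq_sym; apply/negP=> /negP; rewrite -mem_supp => /supp_atom[L].
by move=> FL yL; apply: off; exists L.
Qed.

Lemma assemble_res (N M : finType) (w : bij N M) (a : Exp P M) :
  asm (bmap (Exp P) w a) = res E w (asm a).
Proof.
apply/ffunP=> y; rewrite resE; set a' := bmap _ w a.
have a'E L : on_block a' L = omap (bmap P (corestr w L)) (on_block a (w @: L)).
  exact: on_block_exp_map.
have a'S L : isSome (on_block a' L) = isSome (on_block a (w @: L)).
  by rewrite a'E; case: (on_block a _).
have [[L aL /imsetP[z _ ->]]|off] :=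
    pselect (exists2 L, isSome (on_block a' L) & y \in Ysub Y L).
  move: aL; rewrite a'E; case aL: (on_block a (w @: L)) => [p|//] _.
  rewrite (@assemble_on _ _ L (bmap P (corestr w L) p)); last by rewrite a'E aL.
  rewrite resE -(assemble_on _ aL) -!Ymap_comp; congr (asm a _).
  exact: Ymap_eq.
rewrite !assemble_off // => L aL; apply/negP=> yL; apply: off; last by exists L.
have wL : w @: (w @^-1: L) = L.
  apply/setP=> x; apply/imsetP/idP => [[z]|xL]; first by rewrite inE => ? ->.
  by have [g _ gK] := bij_bij w; exists (g x); rewrite ?inE gK.
exists (w @^-1: L); last by rewrite -Ysub_preim.
by rewrite a'S wL.
Qed.

Lemma fun_species_exponential : exponential E P Phi.
Proof.
split=> [[F]|N|]; last exact: assemble_res.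
  by case/andP; rewrite card_void.
by exists (@atoms N); [apply: assembleK | apply: atomsK].
Qed.

Lemma assemble_one_member (N : finType) (N_gt0 : (0 < #|N|)%N) (p : P N) :
  asm (one_member N_gt0 p) = val p.
Proof.
apply/ffunP=> y; have /imsetP[z _ ->] := YsubT y.
rewrite (@assemble_on _ _ setT (bmap P (incl_setT (erefl _)) p)).
  by rewrite resE.
rewrite /on_block /= ffunE; case: eqP => // e.
by congr (Some (bmap P _ p)); apply: bij_ext.
Qed.

(** * Joins *)

Section Join.

Variables (N I : finType) (K : I -> {set N}).

(** The unions of assemblies, seen as functions: one direction compares values
    on the blocks, the other one uses that the K_i split u, so that the atoms
    of u are those of its restrictions. *)
Lemma is_joinP (s : forall i, E (sub (K i))) (u : E N) :
    (forall i j, i != j -> [disjoint K i & K j]) ->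
    (forall x, exists i, x \in K i) ->
  is_join Phi s u <->
  (forall i, restr (K i) u = s i) /\ supp u \subset \bigcup_i Ysub Y (K i).
Proof.
move=> Kdis Kcov; have inclT i := incl_imsetT (K i).
split=> [[a [b [as_ bu [ab ba]]]]|[us /subsetP uK]].
  split=> [i|]; last first.
    apply/subsetP=> y; rewrite -bu => /supp_atom[L]; rewrite atom_assemble.
    move=> /ba[i [L' [_ ->]]] yL; apply/bigcupP; exists i => //.
    by apply: Ysub_mono yL; apply/subsetP=> x /imsetP[t _ ->]; apply: (valP t).
  rewrite -as_ -bu; apply/ffunP=> z; rewrite resE.
  have [[L aL /imsetP[t _ zt]]|off] :=
      pselect (exists2 L, isSome (on_block (a i) L) & z \in Ysub Y L).
    have := ab i L aL; case aLp: (on_block (a i) L) aL => [p|//] _.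
    case bL: (on_block b _) => [q|//] [qp].
    rewrite zt (assemble_on _ aLp) -qp resE -(assemble_on _ bL) -!Ymap_comp.
    by congr (asm b _); apply: Ymap_eq.
  rewrite [RHS]assemble_off => [|L aL]; last first.
    by apply/negP=> zL; apply: off; exists L.
  rewrite assemble_off // => L aL; apply/negP=> zL; apply: off.
  have [j [L' [aL' eL]]] := ba L aL; move: zL.
  have [eij|ij] := eqVneq j i; last first.
    rewrite eL Ysub_preim => /(Ysub_disjoint _) zL; exfalso.
    apply: (zL setT); last exact: YsubT.
    rewrite -setI_eq0 setIT; apply/eqP/setP=> x; rewrite !inE.
    apply/negP=> /imsetP[t _ xt].
    have /disjoint_setI0/setP/(_ (incl (K i) x)) := Kdis _ _ ij.
    by rewrite !inE {1}xt (valP t) (valP x).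
  case: i / eij z => z in L' aL' eL *.
  by rewrite eL Ysub_map => zL'; exists L'.
have uKi i : splits u (K i).
  apply/splitsP=> y /uK/bigcupP[j _ yj].
  have [<-|ij] := eqVneq j i; first by left.
  by right; apply: Ysub_mono yj; rewrite -disjoints_subset Kdis.
exists (fun i => atoms (s i)), (atoms u); split=> [i||]; try exact: atomsK.
split=> [i L|L]; rewrite !isSome_on_block_atoms.
  rewrite -us !on_block_atoms => aL; have := aL; rewrite atom_ext ?inclT // => bL.
  have pa : primitive (restr L (restr (K i) u)).
    by rewrite primitive_restr //; case/atomP: aL.
  have pb : primitive (restr (incl (K i) @: L) u).
    by rewrite primitive_restr //; case/atomP: bL.
  rewrite bL (insubT _ pb) (insubT _ pa); congr Some; apply/val_inj/esym.
  exact: restr_imset.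
move=> uL; have /atomP[/set0Pn[x xL] _ mL] := uL.
have [i xi] := Kcov x; exists i, (incl (K i) @^-1: L).
have eL : L = incl (K i) @: (incl (K i) @^-1: L).
  have /orP[/disjoint_setI0/setP/(_ x)|/subsetP LK] := mL _ (uKi i).
    by rewrite !inE xL xi.
  apply/setP=> z; apply/idP/imsetP => [zL|[t]]; last by rewrite inE => ? ->.
  by exists (exist _ z (LK z zL)); rewrite ?inE.
by rewrite isSome_on_block_atoms -us atom_ext ?inclT // -eL.
Qed.

End Join.

(** The traces of the blocks on K are disjoint and cover K, so that [is_joinP]
    reduces coherence to the functoriality of restriction. *)
Lemma fun_species_coherent : coherent E P Phi.
Proof.
move=> N a K; apply/is_joinP.
- move=> L L' LL'; rewrite -setI_eq0 -preimsetI.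
  have [/disjoint_setI0->|dis] := boolP [disjoint val L & val L'].
    by rewrite preimset0.
  have /val_inj/eqP := on_block_meet (valP L) (valP L') dis.
  by rewrite (negPf LL').
- move=> x; have [L aL xL] := on_block_cover a (incl K x).
  by exists (exist _ L aL); rewrite inE.
split=> [L|].
  rewrite assemble_one_member -(restr_assemble (on_block_member L)).
  by rewrite /restr -!res_comp; apply: res_eq.
apply/subsetP=> y; rewrite mem_supp resE -mem_supp => /supp_atom[L].
rewrite atom_assemble Ysub_preim => aL yL; apply/bigcupP.
by exists (exist _ L aL).
Qed.

Lemma is_dunionP (N : finType) (K : {set N}) (s : E (sub K)) (t : E (sub (~: K)))
    (u : E N) :
  is_dunion Phi s t u <-> [/\ restr K u = s, restr (~: K) u = t & splits u K].
Proof.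
rewrite /is_dunion is_joinP; first last.
- by move=> x; have [xK|xK] := boolP (x \in K); [exists true | exists false; rewrite inE].
- by move=> [] [] // _; rewrite -setI_eq0 ?setICr // setIC setICr.
rewrite /splits (_ : \bigcup_i _ = Ysub Y K :|: Ysub Y (~: K)); last first.
  by rewrite big_bool.
split=> [[us ->]|[us ut uK]]; first by rewrite -(us true) -(us false).
by split=> // -[].
Qed.

(** * Disjoint unions on sum types *)

Definition inlI (A B : finType) : inj A (A + B)%type := Inj (@inl_inj A B).
Definition inrI (A B : finType) : inj B (A + B)%type := Inj (@inr_inj A B).

Lemma setC_inl (A B : finType) : ~: (inlI A B @: setT) = inrI A B @: setT.
Proof.
apply/setP=> -[x|x]; rewrite !inE.
  by rewrite imset_f //; apply/esym/negP=> /imsetP[].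
by rewrite [RHS]imset_f //; apply/negP=> /imsetP[].
Qed.

(** [fun_dunion] glues along the inclusions of a subset and of its complement,
    and [fsum] along the inclusions into a sum type. *)
Section Glue.

Variables (A B N : finType) (i : inj A N) (j : inj B N).
Hypothesis ij : ~: (i @: setT) = j @: setT.

Definition glue (F : E A) (G : E B) : E N :=
  [ffun y => if [pick z | Ymap Y i z == y] is Some z then F z
             else if [pick z | Ymap Y j z == y] is Some z then G z
             else triv Hhat].

Lemma res_gluel (F : E A) (G : E B) : res E i (glue F G) = F.
Proof.
apply/ffunP=> y; rewrite resE ffunE; case: pickP => [z /eqP/inj_inj->//|no].
by have /eqP := no y.
Qed.

Lemma res_gluer (F : E A) (G : E B) : res E j (glue F G) = G.
Proof.
apply/ffunP=> y; rewrite resE ffunE; case: pickP => [z /eqP zy|_].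
  exfalso; apply: (@Ysub_disjoint Y _ (i @: setT) (j @: setT)).
  - by rewrite -ij -setI_eq0 setICr.
  - exact: mem_Ysub_im z.
  - by rewrite zy mem_Ysub_im.
by case: pickP => [z /eqP/inj_inj->//|no]; have /eqP := no y.
Qed.

Lemma splits_glue (F : E A) (G : E B) : splits (glue F G) (i @: setT).
Proof.
apply/splitsP=> y; rewrite mem_supp ffunE ij.
case: pickP => [z /eqP<- _|_]; first by left; apply: mem_Ysub_im.
by case: pickP => [z /eqP<- _|_ /eqP//]; right; apply: mem_Ysub_im.
Qed.

(** Away from the images of Y_A and Y_B both functions are trivial. *)
Lemma splits_inj (u v : E N) :
  splits u (i @: setT) -> splits v (i @: setT) ->
  res E i u = res E i v -> res E j u = res E j v -> u = v.
Proof.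
move=> /splitsP ui /splitsP vi eqi eqj; rewrite ij in ui vi.
apply/ffunP=> y.
have [|off] := boolP (y \in Ysub Y (i @: setT) :|: Ysub Y (j @: setT)).
  by case/setUP=> /Ysub_imP[z ->]; rewrite -!resE ?eqi ?eqj.
have off_triv (w : E N) : (forall y, y \in supp w ->
    y \in Ysub Y (i @: setT) \/ y \in Ysub Y (j @: setT)) -> w y = triv Hhat.
  move=> w_supp; apply/eqP; apply: contraR off; rewrite -mem_supp => /w_supp.
  by case=> yi; rewrite inE yi ?orbT.
by rewrite !off_triv.
Qed.

End Glue.

Definition fsum (A B : finType) (F : E A) (G : E B) : E (A + B)%type :=
  glue (inlI A B) (inrI A B) F G.

Lemma res_inl (A B : finType) (F : E A) (G : E B) :
  res E (inlI A B) (fsum F G) = F.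
Proof. exact: res_gluel. Qed.

Lemma res_inr (A B : finType) (F : E A) (G : E B) :
  res E (inrI A B) (fsum F G) = G.
Proof. exact/res_gluer/setC_inl. Qed.

Lemma splits_fsum (A B : finType) (F : E A) (G : E B) :
  splits (fsum F G) (inlI A B @: setT).
Proof. exact/splits_glue/setC_inl. Qed.

Lemma fun_dunionP (N : finType) (K : {set N}) (F : E (sub K)) (G : E (sub (~: K))) :
  [/\ restr K (fun_dunion F G) = F, restr (~: K) (fun_dunion F G) = G
    & splits (fun_dunion F G) K].
Proof.
have inclC : ~: (incl K @: setT) = incl (~: K) @: setT by rewrite !incl_imsetT.
have := splits_glue inclC F G; rewrite incl_imsetT; split=> //.
  exact: res_gluel.
exact: res_gluer.
Qed.

Lemma fun_dunionE (N : finType) (K : {set N}) (u : E N) :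
  splits u K -> fun_dunion (restr K u) (restr (~: K) u) = u.
Proof.
have [eK eC splitK] := fun_dunionP (restr K u) (restr (~: K) u).
by move=> uK; apply: (@splits_inj _ _ _ (incl K) (incl (~: K))); rewrite ?incl_imsetT.
Qed.

End Atoms.

(** * Additive maps, free abelian groups and tensor products *)

Section Additive.

Variables (V W : zmodType) (f : V -> W).
Hypothesis fB : zmod_morphism f.

Let fA : {additive V -> W} := HB.pack f (GRing.isZmodMorphism.Build V W f fB).

Lemma zm0 : f 0 = 0. Proof. exact: (raddf0 fA). Qed.
Lemma zmN x : f (- x) = - f x. Proof. exact: (raddfN fA). Qed.
Lemma zm_sum (I : Type) (r : seq I) (Q : pred I) (F : I -> V) :
  f (\sum_(i <- r | Q i) F i) = \sum_(i <- r | Q i) f (F i).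
Proof. exact: (raddf_sum fA). Qed.
End Additive.

(** The coefficients being integers, differences of basis elements suffice. *)
Lemma freeg_span (T : choiceType) (Q : {freeg T} -> Prop) :
  Q 0 -> (forall x y, Q x -> Q y -> Q (x - y)) -> (forall t, Q << t >>) ->
  forall d, Q d.
Proof.
move=> Q0 QB QU d.
have QN x : Q x -> Q (- x) by move=> /(QB 0); rewrite sub0r; apply.
have QD x y : Q x -> Q y -> Q (x + y).
  by move=> Qx /QN Qy; rewrite -[y]opprK; apply: QB.
rewrite -[d]freeg_sumE; apply: big_ind => // t _.
have QMn n : Q (<< t >> *+ n) by elim: n => // n IHn; rewrite mulrS; apply: QD.
rewrite -[coeff t d]intz -freegU_mulz; case: (coeff t d) => n; first exact: QMn.
by rewrite NegzE mulrNz; apply/QN/QMn.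
Qed.

Lemma zlift_subf (T : choiceType) (V : zmodType) (f g : T -> V) d :
  zlift (fun t => f t - g t) d = zlift f d - zlift g d.
Proof.
elim/freeg_span: d => [|x y IHx IHy|t]; last by rewrite !zliftU.
  by rewrite !(zm0 (zliftB _)) subrr.
by rewrite !zliftB IHx IHy !opprD !opprK addrACA.
Qed.

Section TensorTheory.

Variables V W : zmodType.

Lemma tensDl (v v' : V) (w : W) : tens (v + v') w = tens v w + tens v' w.
Proof.
apply/eqP; rewrite -subr_eq0 opprD addrA -!raddfB -(raddf0 (zpi _)); apply/eqP.
by apply/zpi_eq; rewrite subr0; apply/zspan_gen/tensor_relDl.
Qed.

Lemma tensDr (v : V) (w w' : W) : tens v (w + w') = tens v w + tens v w'.
Proof.
apply/eqP; rewrite -subr_eq0 opprD addrA -!raddfB -(raddf0 (zpi _)); apply/eqP.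
by apply/zpi_eq; rewrite subr0; apply/zspan_gen/tensor_relDr.
Qed.

Lemma tens_biadditive : biadditive (@tens V W).
Proof.
split=> [w v v'|v w w'].
  by rewrite -[v in RHS](subrK v') [in RHS]tensDl addrK.
by rewrite -[w in RHS](subrK w') [in RHS]tensDr addrK.
Qed.

Lemma tlift_subf (U : zmodType) (f g : V -> W -> U) x :
  tlift (fun v w => f v w - g v w) x = tlift f x - tlift g x.
Proof. exact: zlift_subf. Qed.

Lemma eq_tlift (U : zmodType) (f g : V -> W -> U) x :
  (forall v w, f v w = g v w) -> tlift f x = tlift g x.
Proof. by move=> fg; congr tlift; do 2!apply: funext => ?; apply: fg. Qed.

(** Since [tlift f x] is computed on a representative of x, it depends
    additively on f. *)
Lemma tlift_param (T U : zmodType) (f : T -> V -> W -> U) x :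
  (forall v w, zmod_morphism (fun t => f t v w)) ->
  zmod_morphism (fun t => tlift (f t) x).
Proof.
by move=> fB t t'; rewrite -tlift_subf; apply: eq_tlift => v w; apply: fB.
Qed.

End TensorTheory.

Lemma biadditive_comp (A B T U X : zmodType) (m : A -> B -> X) (f : T -> A) (g : U -> B) :
  biadditive m -> zmod_morphism f -> zmod_morphism g ->
  biadditive (fun t u => m (f t) (g u)).
Proof.
move=> [ml mr] fB gB; split=> [u t t'|t u u']; first by rewrite fB ml.
by rewrite gB mr.
Qed.

Section TensorMapTheory.

Variables A B C D : zmodType.

Lemma tmapB (f : A -> C) (g : B -> D) :
  zmod_morphism f -> zmod_morphism g -> zmod_morphism (tmap f g).
Proof.
by move=> fB gB; apply/tliftB; apply: biadditive_comp (tens_biadditive _ _) fB gB.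
Qed.

Lemma tmapE (f : A -> C) (g : B -> D) a b :
  zmod_morphism f -> zmod_morphism g -> tmap f g (tens a b) = tens (f a) (g b).
Proof.
by move=> fB gB; apply/tliftE; apply: biadditive_comp (tens_biadditive _ _) fB gB.
Qed.

Let assoc_biadditive (c : C) :
  biadditive (fun (a : A) (b : B) => tens a (tens b c)).
Proof.
have [tl tr] := tens_biadditive A (tensor B C).
have [tl' tr'] := tens_biadditive B C.
by split=> [b a a'|a b b']; rewrite ?tl ?tl' ?tr.
Qed.

Let tassoc_biadditive :
  biadditive (fun ab (c : C) =>
    tlift (fun (a : A) (b : B) => tens a (tens b c)) ab).
Proof.
split=> [c|ab]; first exact/tliftB/assoc_biadditive.
apply: tlift_param => a b c c'.
have [_ tr] := tens_biadditive A (tensor B C).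
by have [_ tr'] := tens_biadditive B C; rewrite tr' tr.
Qed.

Lemma tassocB : zmod_morphism (@tassoc A B C).
Proof. exact: tliftB. Qed.

Lemma tassocE a b c :
  tassoc (tens (tens a b) c) = tens a (tens b c) :> tensor A (tensor B C).
Proof. by rewrite /tassoc tliftE // tliftE. Qed.

Variable m : A -> A -> A.
Hypothesis m_biadditive : biadditive m.

Let tmul1_biadditive (a b : A) :
  biadditive (fun c d => tens (m a c) (m b d)).
Proof.
have [_ mr] := m_biadditive.
exact: biadditive_comp (tens_biadditive _ _) (mr a) (mr b).
Qed.

Let tmul2_biadditive (y : tensor A A) :
  biadditive (fun a b => tlift (fun c d => tens (m a c) (m b d)) y).
Proof.
have [ml _] := m_biadditive; have [tl tr] := tens_biadditive A A.
by split=> [b|a]; apply: tlift_param => c d x x'; rewrite ml ?tl ?tr.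
Qed.

Lemma tmul_biadditive : biadditive (tmul m).
Proof.
split=> [y|x]; first exact: tliftB.
by apply: tlift_param => a b; apply: tliftB.
Qed.

Lemma tmulE a b c d : tmul m (tens a b) (tens c d) = tens (m a c) (m b d).
Proof. by rewrite /tmul tliftE // tliftE. Qed.

End TensorMapTheory.

(** * Isomorphism classes *)

Section IsoClasses.

Variables (k : closedFieldType) (gT : finGroupType) (H : {group gT}).
Variables (Hhat : irrType k H) (Y : youngSet).

Local Notation E := (fun_species Hhat Y).

Definition std_bij (N : finType) : bij 'I_#|N| N :=
  @Bij _ _ (std N) (Bijective (@enum_valK N) (@enum_rankK N)).

Lemma bij_inv (N M : finType) (w : bij N M) :
  exists v : bij M N, (forall x, v (w x) = x) /\ (forall x, w (v x) = x).
Proof.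
have [g wK gK] := bij_bij w.
by exists (@Bij _ _ (Inj (can_inj gK)) (Bijective gK wK)).
Qed.

Lemma iso_class_ofP (N M : finType) (F : E N) (G : E M) :
  iso_class_of F = iso_class_of G <-> exists w : bij N M, res E w G = F.
Proof.
have [v [vK Kv]] := bij_inv (std_bij N); have [u [uK Ku]] := bij_inv (std_bij M).
split=> [/eqmodP/asboolP[/= w wG]|[w wG]].
  exists (comp_bij (std_bij M) (comp_bij w v)).
  have -> : F = res E v (res E (std N) F).
    by rewrite -res_comp -[LHS](@res_id E); apply: res_eq => x; exact/esym/Kv.
  by rewrite -[res E (std N) F]wG -!res_comp; apply: res_eq.
apply/eqmodP/asboolP.
exists (comp_bij u (comp_bij w (std_bij N))).
rewrite -wG /tagged -!res_comp; apply: res_eq => x; exact: Ku.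
Qed.

(** A function on classes is computed on a representative; this isomorphism
    removes the choice. *)
Lemma iso_class_repr (N : finType) (F : E N) :
  exists w : bij 'I_(tag (generic_quotient.repr (iso_class_of F))) N,
    res E w F = tagged (generic_quotient.repr (iso_class_of F)).
Proof.
have : \pi_(iso_class E) (generic_quotient.repr (iso_class_of F)) = iso_class_of F.
  by rewrite generic_quotient.reprK.
move=> /eqmodP/asboolP[w wF]; exists (comp_bij (std_bij N) w).
by rewrite -wF -[RHS]res_comp.
Qed.

End IsoClasses.

(** * Hopf algebras based on the functions *)

Section BasedHopf.

Variables (k : closedFieldType) (gT : finGroupType) (H : {group gT}).
Variables (Hhat : irrType k H) (Y : youngSet).

Local Notation E := (fun_species Hhat Y).

Definition triv_fun (N : finType) : E N := [ffun=> triv Hhat].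

(* The Hopf algebra is constructed on any group V identified with the free
   group on the isomorphism classes: for coord = comb = id it is B_E, and with
   the coordinates of a representation it is B^Delta. *)
Variables (V : zmodType) (coord : V -> BE E) (comb : BE E -> V).
Hypotheses (coordB : zmod_morphism coord) (combB : zmod_morphism comb).
Hypotheses (coordK : cancel coord comb) (combK : cancel comb coord).

Definition cls (N : finType) (F : E N) : V := comb (bcls F).

Lemma cls_res (N M : finType) (w : bij N M) (F : E M) : cls (res E w F) = cls F.
Proof. by congr (comb << _ >>); apply/iso_class_ofP; exists w. Qed.

Definition invariant (U : Type) (f : forall N : finType, E N -> U) : Prop :=
  forall (N M : finType) (w : bij N M) (F : E M), f N (res E w F) = f M F.

(** Computed on representatives of the classes, hence meaningful when f is
    invariant under isomorphism. *)
Definition extend (U : zmodType) (f : forall N : finType, E N -> U) (x : V) : U :=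
  zlift (fun c : iso_class E => f _ (tagged (generic_quotient.repr c))) (coord x).

Lemma extendB (U : zmodType) (f : forall N : finType, E N -> U) :
  zmod_morphism (extend f).
Proof. by move=> x y; rewrite /extend coordB; apply: zliftB. Qed.

Lemma extendE (U : zmodType) (f : forall N : finType, E N -> U) (N : finType) (F : E N) :
  invariant f -> extend f (cls F) = f N F.
Proof.
move=> f_inv; rewrite /extend combK zliftU.
by have [w <-] := iso_class_repr F; apply: f_inv.
Qed.

Lemma extend_param (T U : zmodType) (f : T -> forall N : finType, E N -> U) x :
  (forall N F, zmod_morphism (fun t => f t N F)) ->
  zmod_morphism (fun t => extend (f t) x).
Proof.
move=> fB t t'; rewrite /extend -zlift_subf; congr zlift.
by apply: funext => c; apply: fB.
Qed.

Lemma cls_span (Q : V -> Prop) :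
  Q 0 -> (forall x y, Q x -> Q y -> Q (x - y)) ->
  (forall (N : finType) (F : E N), Q (cls F)) -> forall x, Q x.
Proof.
move=> Q0 QB QU x; rewrite -[x]coordK.
elim/freeg_span: (coord x) => [|d d' IHd IHd'|c]; first by rewrite (zm0 combB).
  by rewrite combB; apply: QB.
have -> : << c >> = bcls (tagged (generic_quotient.repr c)) :> BE E; last exact: QU.
congr << _ >>; rewrite -[LHS]generic_quotient.reprK.
case: (generic_quotient.repr c) => n s /=.
apply/eqmodP/asboolP; have [v [vK Kv]] := bij_inv (std_bij 'I_n).
exists v; rewrite -[LHS]res_comp -[RHS](@res_id E); apply: res_eq => x'; exact: Kv.
Qed.

Lemma cls_ext (U : zmodType) (f g : V -> U) :
  zmod_morphism f -> zmod_morphism g ->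
  (forall (N : finType) (F : E N), f (cls F) = g (cls F)) -> forall x, f x = g x.
Proof.
move=> fB gB fg; apply: cls_span => // [|x y fgx fgy]; first by rewrite !zm0.
by rewrite fB gB fgx fgy.
Qed.

(** * The product *)

(** The bilinear extension of the disjoint union on sum types; any other model
    of the disjoint union gives the same class, by [cls_fsum]. *)
Definition cmul (x y : V) : V :=
  extend (fun A F => extend (fun B G => cls (fsum F G)) y) x.

Lemma cmul_biadditive : biadditive cmul.
Proof.
split=> [y|x]; first exact: extendB.
by apply: extend_param => A F; apply: extendB.
Qed.

Definition copair (A B N : finType) (i : inj A N) (j : inj B N) (x : A + B) : N :=
  match x with inl a => i a | inr b => j b end.

Lemma copair_bij (A B N : finType) (i : inj A N) (j : inj B N) :
  ~: (i @: setT) = j @: setT -> bijective (copair i j).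
Proof.
move=> ij; have disj a b : i a <> j b.
  move=> ab; have : j b \in j @: setT by rewrite imset_f.
  by rewrite -ij inE -ab imset_f.
apply: inj_card_bij.
  move=> [a|b] [a'|b'] /= e; first by rewrite (inj_inj e).
  - by case: (disj _ _ e).
  - by case: (disj _ _ (esym e)).
  - by rewrite (inj_inj e).
rewrite card_sum -(cardsC (i @: setT)) ij !card_imset ?cardsT //; exact: inj_inj.
Qed.

Lemma cls_fsum (A B N : finType) (i : inj A N) (j : inj B N) (u : E N) :
  ~: (i @: setT) = j @: setT -> splits u (i @: setT) ->
  cls (fsum (res E i u) (res E j u)) = cls u.
Proof.
move=> ij ui; have cb := copair_bij ij.
pose w := @Bij _ _ (Inj (ssrfun.bij_inj cb)) cb.
rewrite -(cls_res w u); congr cls; apply/esym.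
apply: (splits_inj (setC_inl A B)).
- have -> : inlI A B @: setT = w @^-1: (i @: setT); last exact: splits_res.
  apply/setP=> x; rewrite inE; apply/imsetP/imsetP => -[a _].
    by move=> ->; exists a.
  case: x => /= [a'|b'] e; first by exists a'.
  have : j b' \in j @: setT by rewrite imset_f.
  by rewrite -ij inE e imset_f.
- exact: splits_fsum.
- by rewrite res_inl -res_comp; apply: res_eq.
- by rewrite res_inr -res_comp; apply: res_eq.
Qed.

Lemma comp_imsetT (A B C : finType) (v : inj B C) (w : bij A B) :
  comp_inj v w @: setT = v @: setT.
Proof.
apply/setP=> x; apply/imsetP/imsetP => -[z _ ->]; first by exists (w z).
by have [g _ gK] := bij_bij w; exists (g z); rewrite //= gK.
Qed.

Lemma cmulE (A B : finType) (F : E A) (G : E B) :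
  cmul (cls F) (cls G) = cls (fsum F G).
Proof.
have inv_r (A' : finType) (F' : E A') : invariant (fun B G => cls (fsum F' G)).
  move=> B1 B2 w G2; rewrite -{1}(res_inl F' G2) -{2}(res_inr F' G2) -res_comp.
  apply: cls_fsum; last exact: splits_fsum.
  by rewrite setC_inl comp_imsetT.
rewrite /cmul extendE ?extendE // => A1 A2 w F2.
rewrite !extendE // -{1}(res_inr F2 G) -{1}(res_inl F2 G) -res_comp.
apply: cls_fsum; rewrite comp_imsetT; first exact: setC_inl.
exact: splits_fsum.
Qed.

(** * Classes of restrictions *)

(** Working with the classes of the restrictions of one function to subsets of
    one set N replaces iterated restrictions to subsets of subsets. *)
Definition rcls (N : finType) (F : E N) (A : {set N}) : V := cls (restr A F).

Lemma rcls_res (N M : finType) (w : inj N M) (F : E M) (A : {set N}) :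
  rcls (res E w F) A = rcls F (w @: A).
Proof. by rewrite /rcls restr_imset cls_res. Qed.

Lemma rclsT (N : finType) (F : E N) : rcls F setT = cls F.
Proof. exact: (cls_res (incl_setT (erefl _))). Qed.

Lemma rcls_im (N M : finType) (w : inj N M) (F : E M) :
  rcls F (w @: setT) = cls (res E w F).
Proof. by rewrite -rcls_res rclsT. Qed.

Lemma cmul_splits (N : finType) (u : E N) (K : {set N}) :
  splits u K -> cmul (rcls u K) (rcls u (~: K)) = cls u.
Proof. by move=> uK; rewrite cmulE cls_fsum ?incl_imsetT. Qed.

Lemma incl_preim (N : finType) (K L : {set N}) :
  incl K @: (incl K @^-1: L) = K :&: L.
Proof.
apply/setP=> x; apply/imsetP/setIP => [[z]|[xK xL]].
  by rewrite inE => zL ->; split=> //; apply: (valP z).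
by exists (exist _ x xK); rewrite ?inE.
Qed.

(** The trace of K on A splits the restriction of u to A. *)
Lemma rcls_split (N : finType) (u : E N) (K A : {set N}) :
  splits u K -> rcls u A = cmul (rcls u (A :&: K)) (rcls u (A :\: K)).
Proof.
move=> uK; have uK' := splits_res (incl A) uK.
by rewrite [LHS]/rcls /restr -(cmul_splits uK') !rcls_res -preimsetC !incl_preim setDE.
Qed.

Lemma cmul_rcls (N : finType) (u : E N) (A B : {set N}) :
  splits u A -> [disjoint A & B] -> cmul (rcls u A) (rcls u B) = rcls u (A :|: B).
Proof.
move=> uA AB; rewrite (rcls_split (A :|: B) uA) setDUl setDv set0U setUK.
by congr (cmul _ (rcls u _)); apply/esym/setDidPl; rewrite disjoint_sym.
Qed.

(** Any two classes are classes of complementary restrictions of one function,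
    and any three are classes of restrictions to disjoint splitting sets: so
    the identities of the product can be checked inside one function. *)
Lemma cls_pair (A B : finType) (F : E A) (G : E B) :
  exists (N : finType) (u : E N) (K : {set N}),
    [/\ splits u K, cls F = rcls u K & cls G = rcls u (~: K)].
Proof.
exists (A + B)%type, (fsum F G), (inlI A B @: setT).
by rewrite setC_inl !rcls_im res_inl res_inr splits_fsum.
Qed.

Lemma cls_triple (A B C : finType) (F : E A) (G : E B) (L : E C) :
  exists (N : finType) (u : E N) (A' B' C' : {set N}),
    [/\ splits u A', splits u B', [disjoint A' & B'], [disjoint A' & C']
      & [disjoint B' & C']]
    /\ [/\ cls F = rcls u A', cls G = rcls u B' & cls L = rcls u C'].
Proof.
have [N [u [K [uK eF eG]]]] := cls_pair F G.
pose u3 := fsum u L; have u3K := splits_fsum u L.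
exists (N + C)%type, u3, (inlI N C @: K), (inlI N C @: (~: K)), (inrI N C @: setT).
split; last by rewrite -!rcls_res res_inl rclsT res_inr.
split; try by apply: splits_ext => //; rewrite res_inl // splitsC.
- rewrite -setI_eq0 -imsetI ?setICr ?imset0 // => x y _ _; exact: inj_inj.
- by rewrite -setC_inl disjoints_subset setCK imsetS.
- by rewrite -setC_inl disjoints_subset setCK imsetS.
Qed.

Lemma cmulA : associative cmul.
Proof.
have [ml mr] := cmul_biadditive.
move=> x y z.
apply: (@cls_ext _ (fun x => cmul x (cmul y z)) (fun x => cmul (cmul x y) z)).
- by move=> ? ?; rewrite ml.
- by move=> ? ?; rewrite !ml.
move=> A F; apply: (@cls_ext _ (fun y => cmul _ (cmul y z)) (fun y => cmul (cmul _ y) z)).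
- by move=> ? ?; rewrite ml mr.
- by move=> ? ?; rewrite mr ml.
move=> B G; apply: (@cls_ext _ (fun z => cmul _ (cmul _ z)) (fun z => cmul (cmul _ _) z)).
- by move=> ? ?; rewrite !mr.
- by move=> ? ?; rewrite mr.
move=> C L.
have [N [u [A' [B' [C' [[uA uB AB AC BC] [-> -> ->]]]]]]] := cls_triple F G L.
rewrite !cmul_rcls ?setUA //.
- have splitsU : splits u (A' :|: B').
    by rewrite -splitsC setCU; apply: splitsI; rewrite splitsC.
  exact: splitsU.
- by rewrite -setI_eq0 setIUl setU_eq0 !setI_eq0 AC BC.
- by rewrite -setI_eq0 setIUr setU_eq0 !setI_eq0 AB AC.
Qed.

Lemma cmulC : commutative cmul.
Proof.
have [ml mr] := cmul_biadditive.
move=> x y; apply: (@cls_ext _ (fun x => cmul x y) (fun x => cmul y x)) => // A F.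
apply: (@cls_ext _ (fun y => cmul _ y) (fun y => cmul y _)) => // B G.
have [N [u [K [uK -> ->]]]] := cls_pair F G.
have KC : [disjoint K & ~: K] by rewrite -setI_eq0 setICr.
by rewrite cmul_rcls // cmul_rcls ?splitsC 1?disjoint_sym // setUC.
Qed.

Definition cone : V := cls (triv_fun void).

Lemma cls_empty (N : finType) (F : E N) : #|N| = 0%N -> cls F = cone.
Proof.
move=> N0; have f (x : N) : void by case: (notF (etrans (esym (card0_eq N0 x)) _)).
have fb : bijective f.
  by apply: inj_card_bij => [x|]; [case: (f x) | rewrite card_void N0].
rewrite /cone -(cls_res (@Bij _ _ (Inj (ssrfun.bij_inj fb)) fb) (triv_fun void)).
by congr cls; apply/ffunP=> y; have := Y_nonempty y; rewrite N0.
Qed.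

Lemma rcls0 (N : finType) (F : E N) : rcls F set0 = cone.
Proof. by apply: cls_empty; rewrite card_sig cards0. Qed.

Lemma cmul1l : left_id cone cmul.
Proof.
have [ml mr] := cmul_biadditive.
apply: cls_ext => // N F; rewrite -(rcls0 F) -rclsT cmul_rcls ?set0U //.
  exact: splits0.
by rewrite -setI_eq0 set0I.
Qed.

Lemma cmul1r : right_id cone cmul.
Proof. by move=> x; rewrite cmulC cmul1l. Qed.

(** * The coproduct *)

(** The subsets of w A are the images of the subsets of A; Q serves to
    restrict to proper subsets. *)
Lemma sum_imset (U : zmodType) (N M : finType) (w : inj N M) (A : {set N})
    (Q : pred {set M}) (f : {set M} -> U) :
  \sum_(B : {set M} | (B \subset w @: A) && Q B) f B
    = \sum_(C : {set N} | (C \subset A) && Q (w @: C)) f (w @: C).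
Proof.
have wI := @inj_inj _ _ w.
have preK (C : {set N}) : w @^-1: (w @: C) = C.
  by apply/setP=> x; rewrite inE mem_imset.
have imK (B : {set M}) : B \subset w @: A -> w @: (w @^-1: B) = B.
  move=> /subsetP BA; apply/setP=> x; apply/imsetP/idP => [[z]|xB].
    by rewrite inE => ? ->.
  by have /imsetP[z _ xz] := BA x xB; exists z; rewrite // inE -xz.
rewrite (reindex_onto (fun C : {set N} => w @: C)
                      (fun B : {set M} => w @^-1: B)) /=; last first.
  by move=> B /andP[/imK].
apply: eq_bigl => C; rewrite preK eqxx andbT; congr (_ && _).
apply/idP/idP => [/(preimsetS w)|]; [by rewrite !preK | exact: imsetS].
Qed.

Lemma sum_sub (U : zmodType) (N : finType) (A : {set N}) (f : {set N} -> U) :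
  \sum_(B : {set sub A}) f (incl A @: B) = \sum_(B : {set N} | B \subset A) f B.
Proof.
have := sum_imset (incl A) setT xpredT f; rewrite incl_imsetT.
under eq_bigl do rewrite andbT; move=> ->.
by apply: eq_bigl => C; rewrite subsetT.
Qed.

Definition ccop : V -> tensor V V :=
  extend (fun N F => \sum_(A : {set N}) tens (rcls F A) (rcls F (~: A))).

Lemma ccopB : zmod_morphism ccop.
Proof. exact: extendB. Qed.

Lemma ccopE (N : finType) (F : E N) :
  ccop (cls F) = \sum_(A : {set N}) tens (rcls F A) (rcls F (~: A)).
Proof.
apply: (extendE (f := fun N F => \sum_(A : {set N}) tens (rcls F A) (rcls F (~: A)))).
move=> M1 M2 w G; have [v [vK Kv]] := bij_inv w.
have wI := @inj_inj _ _ w.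
have im_v (B : {set M2}) : w @: (v @: B) = B.
  by rewrite -imset_comp -[RHS]imset_id; apply: eq_imset => x /=; rewrite Kv.
have im_w (B : {set M1}) : v @: (w @: B) = B.
  by rewrite -imset_comp -[RHS]imset_id; apply: eq_imset => x /=; rewrite vK.
rewrite [RHS](reindex (fun B : {set M1} => w @: B)) /=; last first.
  by exists (fun B : {set M2} => v @: B) => B _.
apply: eq_bigr => B _; rewrite !rcls_res; congr (tens _ (rcls _ _)).
apply/setP=> x; rewrite inE -[x in LHS]Kv -[x in RHS]Kv !mem_imset ?inE //.
Qed.

(** The coproduct of a restriction, without subsets of subsets *)
Lemma ccop_rcls (N : finType) (F : E N) (A : {set N}) :
  ccop (rcls F A)
    = \sum_(B : {set N} | B \subset A) tens (rcls F B) (rcls F (A :\: B)).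
Proof.
rewrite {1}/rcls ccopE -sum_sub; apply: eq_bigr => B _; rewrite !rcls_res.
congr (tens _ (rcls _ _)); apply/setP=> x; rewrite !inE.
apply/imsetP/andP => [[z zB ->]|[xB xA]].
  by rewrite mem_imset ?(valP z) //; [rewrite inE in zB | apply: inj_inj].
exists (exist _ x xA) => //; rewrite inE; apply: contra xB => xB.
exact: (imset_f (incl A) xB).
Qed.


(** Both sides of coassociativity sum over the ordered partitions of N into
    three parts. *)
Lemma ccopA x : tassoc (tmap ccop id (ccop x)) = tmap id ccop (ccop x).
Proof.
have idB (U : zmodType) : zmod_morphism (@id U) by [].
have m1 := tmapB ccopB (@idB V); have m2 := tmapB (@idB V) ccopB.
have m3 := @tassocB V V V.
apply: (@cls_ext _ (fun x => tassoc (tmap ccop id (ccop x)))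
                  (fun x => tmap id ccop (ccop x))).
- by move=> y z; rewrite ccopB m1 m3.
- by move=> y z; rewrite ccopB m2.
move=> N F; rewrite -rclsT ccop_rcls.
under eq_bigl do rewrite subsetT.
have [_ tr] := tens_biadditive V (tensor V V).
have [tl _] := tens_biadditive (tensor V V) V.
rewrite (zm_sum m1) (zm_sum m2) (zm_sum m3).
under eq_bigr => A _.
  rewrite (tmapE _ _ ccopB (idB V)) ccop_rcls (zm_sum (tl _)) (zm_sum m3).
  under eq_bigr => B _ do rewrite tassocE.
  over.
under [RHS]eq_bigr => A _.
  rewrite (tmapE _ _ (idB V) ccopB) ccop_rcls (zm_sum (tr _)).
  over.
rewrite !pair_big_dep /=.
(* On the left A is the union of the first two parts and B the first one; on
   the right A is the first part and B the second one. *)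
rewrite (reindex_onto (fun p : {set N} * {set N} => (p.1 :|: p.2, p.1))
                      (fun p => (p.2, p.1 :\: p.2))) /=; last first.
  by move=> [A B] /= BA; rewrite setDE setUIr setUCr setIT (setUidPr BA).
apply: eq_big => [[A B]|[A B] /andP[_ /eqP[BA]]] /=; last first.
  by rewrite BA !setTD setCU setDE setIC.
rewrite subsetUl setTD -disjoints_subset xpair_eqE eqxx /=.
rewrite setDUl setDv set0U; by apply/eqP/setDidPl.
Qed.

Definition ccou : V -> int := extend (fun N F => (#|N| == 0%N)%:R).

Lemma ccouE (N : finType) (F : E N) : ccou (cls F) = (#|N| == 0%N)%:R.
Proof.
apply: (extendE (f := fun (N : finType) _ => (#|N| == 0%N)%:R)) => M1 M2 w G.
by rewrite (bij_eq_card (bij_bij w)).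
Qed.

Lemma ccouB : zmod_morphism ccou.
Proof. exact: extendB. Qed.

Lemma ccou_rcls (N : finType) (F : E N) (A : {set N}) :
  ccou (rcls F A) = (A == set0)%:R.
Proof. by rewrite ccouE card_sig cards_eq0. Qed.

Lemma cls_eq_one (N : finType) (F : E N) : (cls F == cone) = (#|N| == 0%N).
Proof.
apply/eqP/eqP => [Fone|]; last exact: cls_empty.
have := ccouE F; rewrite Fone ccouE card_void eqxx.
by case: eqP.
Qed.

Lemma ccop_coul x : tlift (fun a b => b *~ ccou a) (ccop x) = x.
Proof.
have bi : biadditive (fun a b : V => b *~ ccou a).
  by split=> [b a a'|a b b']; rewrite ?ccouB ?mulrzBr ?mulrzBl.
apply: (@cls_ext _ (fun x => tlift _ (ccop x)) id) => // [y z|N F].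
  by rewrite ccopB tliftB.
rewrite ccopE (zm_sum (tliftB bi)) (bigD1 set0) //= tliftE // ccou_rcls eqxx.
rewrite mulr1z setC0 rclsT big1 ?addr0 // => A A0.
by rewrite tliftE // ccou_rcls (negPf A0) mulr0z.
Qed.

Lemma ccop_cour x : tlift (fun a b => a *~ ccou b) (ccop x) = x.
Proof.
have bi : biadditive (fun a b : V => a *~ ccou b).
  by split=> [b a a'|a b b']; rewrite ?ccouB ?mulrzBr ?mulrzBl.
apply: (@cls_ext _ (fun x => tlift _ (ccop x)) id) => // [y z|N F].
  by rewrite ccopB tliftB.
rewrite ccopE (zm_sum (tliftB bi)) (bigD1 setT) //= tliftE // ccou_rcls setCT eqxx.
rewrite mulr1z rclsT big1 ?addr0 // => A AT.
by rewrite tliftE // ccou_rcls -setCT (inj_eq (can_inj (@setCK _))) (negPf AT) mulr0z.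
Qed.

Lemma ccop1 : ccop cone = tens cone cone.
Proof.
rewrite ccopE (big_pred1 set0) => [|A].
  by rewrite rcls0 /rcls cls_empty // card_sig setC0 cardsT card_void.
by apply/esym/eqP/setP=> -[].
Qed.

Lemma ccou1 : ccou cone = 1.
Proof. by rewrite ccouE card_void. Qed.

Lemma ccouM x y : ccou (cmul x y) = ccou x * ccou y.
Proof.
have [ml mr] := cmul_biadditive.
apply: (@cls_ext _ (fun x => ccou (cmul x y)) (fun x => ccou x * ccou y)).
- by move=> ? ?; rewrite ml ccouB.
- by move=> ? ?; rewrite ccouB mulrBl.
move=> A F; apply: (@cls_ext _ (fun y => ccou (cmul _ y)) (fun y => _ * ccou y)).
- by move=> ? ?; rewrite mr ccouB.
- by move=> ? ?; rewrite ccouB mulrBr.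
move=> B G; rewrite cmulE !ccouE card_sum addn_eq0.
by case: eqP => _; rewrite ?mul0r ?mul1r.
Qed.

(** A subset of N is the union of its traces on the two parts of N, and the
    restriction to it is the product of the restrictions to these traces. *)
Lemma ccopM x y : ccop (cmul x y) = tmul cmul (ccop x) (ccop y).
Proof.
have [ml mr] := cmul_biadditive; have [tl tr] := tmul_biadditive cmul_biadditive.
apply: (@cls_ext _ (fun x => ccop (cmul x y)) (fun x => tmul cmul (ccop x) (ccop y))).
- by move=> ? ?; rewrite ml ccopB.
- by move=> ? ?; rewrite ccopB tl.
move=> A F.
apply: (@cls_ext _ (fun y => ccop (cmul _ y)) (fun y => tmul cmul _ (ccop y))).
- by move=> ? ?; rewrite mr ccopB.
- by move=> ? ?; rewrite ccopB tr.
move=> B G; have [N [u [K [uK -> ->]]]] := cls_pair F G.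
rewrite cmul_splits // ccopE !ccop_rcls (zm_sum (tl _)).
under [RHS]eq_bigr => C _.
  rewrite (zm_sum (tr _)); under eq_bigr => D _ do rewrite (tmulE cmul_biadditive).
  over.
rewrite pair_big_dep /=.
rewrite [RHS](reindex_onto (fun C : {set N} => (C :&: K, C :\: K))
                      (fun p => p.1 :|: p.2)) /=; last first.
  move=> [C D] /= /andP[CK DK]; congr (_, _); apply/setP=> z; rewrite !inE.
    have := subsetP CK z; have := subsetP DK z; rewrite !inE.
    by case: (z \in C); case: (z \in D); case: (z \in K) => //= a b; rewrite ?a ?b.
  have := subsetP CK z; have := subsetP DK z; rewrite !inE.
  by case: (z \in C); case: (z \in D); case: (z \in K) => //= a b; rewrite ?a ?b.
apply: eq_big => [C|C _].
  by rewrite subsetIr setDE subsetIr -setIUr setUCr setIT eqxx.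
rewrite (rcls_split C uK) (rcls_split (~: C) uK) /=.
congr (tens _ (cmul _ _)); congr (rcls u _).
  by apply/setP=> z; rewrite !inE; case: (z \in C); case: (z \in K).
by apply/setP=> z; rewrite !inE; case: (z \in C); case: (z \in K).
Qed.

(** * The antipode *)

(** The recursion that inverts the identity for the convolution product, on
    the restrictions of one function; the fuel [d] bounds the size of [A]. *)
Fixpoint anti_rec (N : finType) (F : E N) (d : nat) (A : {set N}) : V :=
  if d is d'.+1 then
    if A == set0 then cone
    else - \sum_(B : {set N} | (B \subset A) && (B != A))
             cmul (anti_rec F d' B) (rcls F (A :\: B))
  else cone.

Lemma anti_rec_fuel (N : finType) (F : E N) d d' (A : {set N}) :
  (#|A| <= d)%N -> (#|A| <= d')%N -> anti_rec F d A = anti_rec F d' A.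
Proof.
elim: d d' A => [|d IHd] [|d'] A //=.
- by rewrite leqn0 cards_eq0 => ->.
- by move=> _; rewrite leqn0 cards_eq0 => ->.
move=> Ad Ad'; case: eqP => // _; congr (- _); apply: eq_bigr => B /andP[BA nBA].
have lt_BA : (#|B| < #|A|)%N by apply: proper_card; rewrite properEneq nBA.
by congr (cmul _ _); apply: IHd; rewrite -ltnS (leq_trans lt_BA).
Qed.

Definition anti (N : finType) (F : E N) (A : {set N}) : V := anti_rec F #|A| A.

(** For A nonempty, the term B = A is S(F|_A) times the unit, which the
    recursion sets equal to minus the sum of the others. *)
Lemma antiE (N : finType) (F : E N) (A : {set N}) :
  \sum_(B : {set N} | B \subset A) cmul (anti F B) (rcls F (A :\: B))
    = cone *~ (A == set0)%:R.
Proof.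
have [ml mr] := cmul_biadditive.
have [->|A0] := eqVneq A set0.
  rewrite (big_pred1 set0) => [|B]; last by rewrite subset0.
  by rewrite setDv rcls0 /anti cards0 cmul1l mulr1z.
rewrite (bigD1 A) //= setDv rcls0 cmul1r {1}/anti.
have : (0 < #|A|)%N by rewrite card_gt0.
case eA : #|A| => [//|d] _ /=; rewrite (negPf A0) mulr0z addrC; apply/eqP.
rewrite subr_eq0; apply/eqP/eq_bigr => B /andP[BA nBA]; congr (cmul _ _).
apply: anti_rec_fuel => //; rewrite -ltnS -eA.
by apply: proper_card; rewrite properEneq nBA.
Qed.

Lemma anti_res (N M : finType) (w : inj N M) (F : E M) (A : {set N}) :
  anti (res E w F) A = anti F (w @: A).
Proof.
have wI := @inj_inj _ _ w.
rewrite /anti (card_imset _ wI).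
suff rec_res d B : anti_rec (res E w F) d B = anti_rec F d (w @: B) by [].
elim: d B => //= d IHd B.
rewrite imset_eq0; case: eqP => // _; congr (- _).
rewrite sum_imset; apply: eq_big => [C|C _].
  by rewrite (inj_eq (imset_inj wI)).
rewrite IHd rcls_res; congr (cmul _ _); congr (rcls F _).
apply/setP=> x; apply/imsetP/setDP => [[z /setDP[zB zC] ->]|[/imsetP[z zB ->]]].
  by rewrite !mem_imset.
by rewrite mem_imset // => zC; exists z; rewrite // inE zC.
Qed.

Definition cant : V -> V := extend (fun N F => anti F setT).

Lemma cantB : zmod_morphism cant.
Proof. exact: extendB. Qed.

Lemma cant_rcls (N : finType) (F : E N) (A : {set N}) :
  cant (rcls F A) = anti F A.
Proof.
rewrite /rcls /cant extendE; last first.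
  move=> M1 M2 w G; rewrite anti_res; congr (anti G _).
  have [v [_ Kv]] := bij_inv w.
  by apply/setP=> x; rewrite inE -[x]Kv imset_f.
by rewrite anti_res incl_imsetT.
Qed.

Lemma cant_left x : tlift (fun a b => cmul (cant a) b) (ccop x) = cone *~ ccou x.
Proof.
have bi : biadditive (fun a b : V => cmul (cant a) b).
  exact: biadditive_comp cmul_biadditive cantB _.
apply: (@cls_ext _ (fun x => tlift _ (ccop x)) (fun x => cone *~ ccou x)).
- by move=> y z; rewrite ccopB tliftB.
- by move=> y z; rewrite ccouB mulrzBr.
move=> N F; rewrite -rclsT ccop_rcls (zm_sum (tliftB bi)) ccou_rcls -(antiE F).
by apply: eq_bigr => B _; rewrite tliftE // cant_rcls.
Qed.

(** The product is commutative and the coproduct is cocommutative, so that a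
    left inverse of the identity is also a right inverse. *)
Lemma cant_right x : tlift (fun a b => cmul a (cant b)) (ccop x) = cone *~ ccou x.
Proof.
have bi : biadditive (fun a b : V => cmul a (cant b)).
  exact: (biadditive_comp (f := id) cmul_biadditive _ cantB).
apply: (@cls_ext _ (fun x => tlift _ (ccop x)) (fun x => cone *~ ccou x)).
- by move=> y z; rewrite ccopB tliftB.
- by move=> y z; rewrite ccouB mulrzBr.
move=> N F; rewrite ccopE (zm_sum (tliftB bi)) -rclsT ccou_rcls -(antiE F).
rewrite (reindex_inj (can_inj (@setCK _))) /=; apply: eq_big => [B|B _].
  by rewrite subsetT.
by rewrite tliftE // cant_rcls cmulC setCK setTD.
Qed.

Let ccopL : {additive V -> tensor V V} :=
  HB.pack ccop (GRing.isZmodMorphism.Build V (tensor V V) ccop ccopB).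
Let ccouL : {additive V -> int} :=
  HB.pack ccou (GRing.isZmodMorphism.Build V int ccou ccouB).
Let cantL : {additive V -> V} :=
  HB.pack cant (GRing.isZmodMorphism.Build V V cant cantB).

(** The common form of [is_BE] and [is_BYH], with the product read off from a
    function split by K rather than from its two parts *)
Definition cls_hopf (A : hopf V) : Prop :=
  [/\ forall (N : finType) (K : {set N}) (u : E N), splits u K ->
        hmul A (cls (restr K u)) (cls (restr (~: K) u)) = cls u,
      forall F : E void, hone A = cls F,
      forall (N : finType) (F : E N),
        hcop A (cls F) =
          \sum_(K : {set N}) tens (cls (restr K F)) (cls (restr (~: K) F))
    & forall (N : finType) (F : E N), hcou A (cls F) = (cls F == hone A)%:R].

Lemma cls_hopf_exists : exists A : hopf V, cls_hopf A.
Proof.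
have ant : exists S : {additive V -> V}, forall x,
    tlift (fun a b => cmul (S a) b) (ccopL x) = cone *~ ccouL x
    /\ tlift (fun a b => cmul a (S b)) (ccopL x) = cone *~ ccouL x.
  by exists cantL => x; split; [apply: cant_left | apply: cant_right].
exists (@Hopf V cmul cone ccopL ccouL cmul_biadditive cmulA cmul1l cmul1r
  ccopA ccop_coul ccop_cour ccopM ccop1 ccouM ccou1 ant).
split=> [N K u uK|F|N F|N F] /=.
- exact: cmul_splits.
- by rewrite cls_empty // card_void.
- exact: ccopE.
- by rewrite cls_eq_one; apply: ccouE.
Qed.

End BasedHopf.

(** The additive map that matches the two bases respects the structures, since
    each of them is determined by its values on the basis. *)
Lemma cls_hopf_isomorphic (k : closedFieldType) (gT : finGroupType)
    (H : {group gT}) (Hhat : irrType k H) (Y : youngSet) (V W : zmodType)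
    (cV : V -> BE (fun_species Hhat Y)) (dV : BE (fun_species Hhat Y) -> V)
    (cW : W -> BE (fun_species Hhat Y)) (dW : BE (fun_species Hhat Y) -> W)
    (A : hopf V) (B : hopf W) :
  zmod_morphism cV -> zmod_morphism dV -> cancel cV dV -> cancel dV cV ->
  zmod_morphism cW -> zmod_morphism dW -> cancel cW dW -> cancel dW cW ->
  cls_hopf dV A -> cls_hopf dW B -> hopf_isomorphic A B.
Proof.
move=> cVB dVB cVK dVK cWB dWB cWK dWK [mulA oneA copA couA] [mulB oneB copB couB].
pose f x := dW (cV x).
have fB : zmod_morphism f by move=> x y; rewrite /f cVB dWB.
have f_cls N F : f (@cls _ _ _ Hhat Y V dV N F) = cls dW F by rewrite /f /cls dVK.
pose fA : {additive V -> W} := HB.pack f (GRing.isZmodMorphism.Build V W f fB).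
exists fA; have [mlA mrA] := hmul_biadditive A; have [mlB mrB] := hmul_biadditive B.
have ext := cls_ext dVB cVK.
have fbij : bijective f.
  by exists (fun y => dV (cW y)) => x; rewrite /f ?dWK ?cVK ?dVK ?cWK.
have f1 : f (hone A) = hone B.
  by rewrite (oneA (triv_fun Hhat Y void)) (oneB (triv_fun Hhat Y void)) f_cls.
split=> // [x y|x|x].
- apply: (@ext _ (fun x => f (hmul A x y)) (fun x => hmul B (f x) (f y))).
  + by move=> ? ?; rewrite mlA fB.
  + by move=> ? ?; rewrite fB mlB.
  move=> N F; apply: (@ext _ (fun y => f (hmul A _ y)) (fun y => hmul B _ (f y))).
  + by move=> ? ?; rewrite mrA fB.
  + by move=> ? ?; rewrite fB mrB.
  move=> M G; have [L [u [K [uK -> ->]]]] := cls_pair dV F G.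
  by rewrite mulA // !f_cls mulB.
- apply: (@ext _ (fun x => hcop B (f x)) (fun x => tmap f f (hcop A x))).
  + by move=> ? ?; rewrite fB raddfB.
  + by move=> ? ?; rewrite raddfB (tmapB fB fB).
  move=> N F; rewrite f_cls copB copA (zm_sum (tmapB fB fB)).
  by apply: eq_bigr => K _; rewrite (tmapE _ _ fB fB) !f_cls.
- apply: (@ext _ (fun x => hcou B (f x)) (fun x => hcou A x)).
  + by move=> ? ?; rewrite fB raddfB.
  + exact: raddfB.
  move=> N F; rewrite f_cls couB couA -f1 -f_cls.
  by rewrite (inj_eq (ssrfun.bij_inj fbij)).
Qed.

(** * Multiplicities of linear characters *)

Section LinearMultiplicity.

Variables (F : fieldType) (gT : finGroupType) (G : {group gT}) (chi : gT -> F).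
Hypothesis chi1 : chi 1%g = 1.
Hypothesis chiM : {in G &, {morph chi : x y / (x * y)%g >-> x * y}}.
Hypothesis cardG_neq0 : #|G|%:R != 0 :> F.

(** #|G| times the projection onto the chi-isotypic part *)
Definition isotypic d (V : mx_representation F G d) : 'M[F]_d :=
  \sum_(g in G) chi g^-1%g *: V g.

Definition mult d (V : mx_representation F G d) : nat := \rank (isotypic V).

Lemma chiV g : g \in G -> chi g^-1%g * chi g = 1.
Proof. by move=> Gg; rewrite -chiM ?groupV // mulVg. Qed.

(** V(h) multiplies the operator by chi(h), as seen by the substitution of g h
    for g in the sum. *)
Lemma isotypicJ d (V : mx_representation F G d) h :
  h \in G -> isotypic V *m V h = chi h *: isotypic V.
Proof.
move=> Gh; rewrite [in RHS]/isotypic (reindex_inj (mulIg h)) /= mulmx_suml scaler_sumr.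
apply: eq_big => [g|g Gg]; first by rewrite groupMr.
rewrite repr_mxM // -scalemxAl scalerA; congr (_ *: _).
by rewrite invMg chiM ?groupV // mulrA [chi h * _]mulrC chiV // mul1r.
Qed.

Lemma isotypicJl d (V : mx_representation F G d) h :
  h \in G -> V h *m isotypic V = chi h *: isotypic V.
Proof.
move=> Gh; rewrite [in RHS]/isotypic (reindex_inj (mulgI h)) /= mulmx_sumr scaler_sumr.
apply: eq_big => [g|g Gg]; first by rewrite groupMl.
rewrite repr_mxM // -scalemxAr scalerA; congr (_ *: _).
by rewrite invMg chiM ?groupV // mulrC -mulrA chiV // mulr1.
Qed.

Lemma isotypic_fixed d (V : mx_representation F G d) m (A : 'M_(m, d)) :
  {in G, forall g, A *m V g = chi g *: A} -> A *m isotypic V = #|G|%:R *: A.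
Proof.
move=> AV; rewrite mulmx_sumr (eq_bigr (fun _ => A)) => [|g Gg].
  by rewrite sumr_const scaler_nat.
by rewrite -scalemxAr AV // scalerA chiV // scale1r.
Qed.

(** The operators e', e, e'' on V', V, V'' satisfy e' i = i e and e p = p e''.
    Hence e p and e'' have the same rank, and it remains to identify the kernel
    of p in the row space of e with the row space of e' i.  A matrix W in both
    row spaces is fixed up to chi by the group, hence #|G| W = W e, and writing
    W = b i gives #|G| W = b e' i. *)
Lemma mult_exact d d' d'' (V : mx_representation F G d)
    (V' : mx_representation F G d') (V'' : mx_representation F G d'')
    (i : 'M_(d', d)) (p : 'M_(d, d'')) :
  {in G, forall g, V' g *m i = i *m V g} ->
  {in G, forall g, V g *m p = p *m V'' g} ->
  row_free i -> row_full p -> (i :=: kermx p)%MS ->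
  mult V = (mult V' + mult V'')%N.
Proof.
move=> iV pV i_free p_full ker_p.
have ei : isotypic V' *m i = i *m isotypic V.
  rewrite mulmx_suml mulmx_sumr; apply: eq_bigr => g Gg.
  by rewrite -scalemxAl iV // scalemxAr.
have ep : isotypic V *m p = p *m isotypic V''.
  rewrite mulmx_suml mulmx_sumr; apply: eq_bigr => g Gg.
  by rewrite -scalemxAl pV // scalemxAr.
rewrite /mult -(mxrank_mul_ker (isotypic V) p) ep (eqmxMfull _ p_full) addnC.
rewrite -(mxrankMfree (isotypic V') i_free); congr (_ + _)%N.
apply/eqmx_rank; apply/andP; split; last first.
  by rewrite sub_capmx {1}ei submxMl -ker_p submxMl.
set W := (_ :&: _)%MS.
have /submxP[a Wa] : (W <= isotypic V)%MS by apply: capmxSl.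
have /submxP[b Wb] : (W <= i)%MS by rewrite ker_p capmxSr.
have Wfix : {in G, forall g, W *m V g = chi g *: W}.
  by move=> g Gg; rewrite Wa -mulmxA isotypicJ // scalemxAr.
have := isotypic_fixed Wfix; rewrite {1}Wb -mulmxA -ei mulmxA => eW.
rewrite -[W]scale1r -(mulVf cardG_neq0) -scalerA -eW -mulmxA.
by rewrite scalemx_sub // submxMl.
Qed.

Lemma mult_self (V : mx_representation F G 1) :
  {in G, forall g, V g = (chi g)%:M} -> mult V = 1%N.
Proof.
move=> Vchi; have : 1%:M *m isotypic V = #|G|%:R *: 1%:M.
  by apply: isotypic_fixed => g Gg; rewrite Vchi // mul1mx scalemx1.
by rewrite /mult mul1mx => ->; rewrite mxrank_scale_nz // mxrank1.
Qed.

(** The group element h acts on the isotypic part both by psi and by chi h. *)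
Lemma mult_other (V : mx_representation F G 1) psi h :
  h \in G -> V h = psi%:M -> psi != chi h -> mult V = 0%N.
Proof.
move=> Gh Vh psi_chi; apply/eqP; rewrite mxrank_eq0.
have := isotypicJl V Gh; rewrite Vh mul_scalar_mx => /eqP.
by rewrite -subr_eq0 -scalerBl scalemx_eq0 subr_eq0 (negPf psi_chi).
Qed.

End LinearMultiplicity.

(** * Linear characters of Fun(Y_N, H) *)

Section FunCharacters.

Variables (k : closedFieldType) (gT : finGroupType) (H : {group gT}).
Hypotheses (char0 : [pchar k] =i pred0) (abH : abelian H).
Variables (Hhat : irrType k H) (Y : youngSet).

Local Notation E := (fun_species Hhat Y).

Lemma splitH : group_splitting_field k H.
Proof. exact: group_closure_closed_field. Qed.

Lemma pchar'H : ([pchar k]^'.-group H)%g.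
Proof. by apply/pgroupP=> p _ _; rewrite inE /= char0. Qed.

Lemma irr_modeE (i : Hhat) h : h \in H -> irr_repr i h = (irr_mode i h)%:M.
Proof.
by move=> Hh; apply: irr_center_scalar; [apply: splitH | rewrite (center_idP abH)].
Qed.

Lemma irr_mode_inj (i j : Hhat) :
  {in H, forall h, irr_mode i h = irr_mode j h} -> i = j.
Proof.
move=> ij; rewrite -(irr_reprK_pchar pchar'H i) -(irr_reprK_pchar pchar'H j).
have linH := irr_degree_abelian splitH abH.
have : {in H, forall h, irr_repr i h = (irr_mode i h)%:M} by apply: irr_modeE.
have : {in H, forall h, irr_repr j h = (irr_mode j h)%:M} by apply: irr_modeE.
move: (irr_repr i) (irr_repr j); rewrite !linH => ri rj jE iE.
apply: (irr_comp_rsim_pchar _ pchar'H); exists 1%:M => // [|h Hh].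
  by rewrite row_free_unit unitmx1.
by rewrite mulmx1 mul1mx iE // jE // ij.
Qed.

(** A linear character is the character of an irreducible representation of
    degree 1, which is isomorphic to its representative. *)
Lemma irr_mode_onto (chi : gT -> k) :
    chi 1%g = 1 -> {in H &, {morph chi : x y / (x * y)%g >-> x * y}} ->
  exists i : Hhat, {in H, forall h, irr_mode i h = chi h}.
Proof.
move=> chi1 chiM.
have chi_repr : mx_repr H (fun h => (chi h)%:M : 'M[k]_1).
  by split=> [|x y Hx Hy]; rewrite ?chi1 // chiM // scalar_mxM.
pose rG := MxRepresentation chi_repr.
have irrG : mx_irreducible rG by apply/mx_abs_irrW/linear_mx_abs_irr.
exists (irr_comp Hhat rG) => h Hh.
have [B e freeB homB] := rsim_irr_comp_pchar Hhat pchar'H irrG.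
have := homB h Hh; rewrite irr_modeE // mul_mx_scalar mul_scalar_mx => /eqP.
rewrite -subr_eq0 -scalerBl scalemx_eq0 subr_eq0 => /orP[/eqP//|/eqP B0].
by move: freeB; rewrite B0 /row_free mxrank0.
Qed.

Definition fun_char (N : finType) (F : E N) (f : {dffun forall _ : Y N, gT}) : k :=
  \prod_(y : Y N) irr_mode (F y) (f y).

Lemma fun_char1 (N : finType) (F : E N) : fun_char F 1%g = 1.
Proof. by apply: big1 => y _; rewrite ffunE irr_mode1. Qed.

Lemma fun_charM (N : finType) (F : E N) :
  {in fun_group H Y N &, {morph fun_char F : f g / (f * g)%g >-> f * g}}.
Proof.
move=> f g /setXnP Hf /setXnP Hg; rewrite /fun_char -big_split; apply: eq_bigr => y _.
by rewrite ffunE irr_modeM ?(center_idP abH) //; apply: splitH.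
Qed.

(** For h in H these functions generate Fun(Y_N, H). *)
Definition single (N : finType) (y : Y N) (h : gT) : {dffun forall _ : Y N, gT} :=
  [ffun z => if z == y then h else 1%g].

Lemma single_group (N : finType) (y : Y N) h :
  h \in H -> single y h \in fun_group H Y N.
Proof. by move=> Hh; apply/setXnP=> z; rewrite ffunE; case: ifP. Qed.

Lemma fun_char_single (N : finType) (F : E N) y h :
  fun_char F (single y h) = irr_mode (F y) h.
Proof.
rewrite /fun_char (bigD1 y) //= ffunE eqxx big1 ?mulr1 // => z zy.
by rewrite ffunE (negPf zy) irr_mode1.
Qed.

Lemma fun_char_sep (N : finType) (F G : E N) :
  F != G -> exists2 f, f \in fun_group H Y N & fun_char F f != fun_char G f.
Proof.
move=> FG; have [y Fy] : exists y, F y != G y.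
  apply/existsP; apply: contraR FG => /existsPn FG.
  by apply/eqP/ffunP => y; apply/eqP; rewrite -[_ == _]negbK FG.
suff [h Hh neq_h] : exists2 h, h \in H & irr_mode (F y) h != irr_mode (G y) h.
  by exists (single y h); rewrite ?single_group // !fun_char_single.
apply/exists_inP; apply: contraR Fy => /exists_inPn eq_h.
by apply/eqP/irr_mode_inj => h Hh; apply/eqP; rewrite -[_ == _]negbK eq_h.
Qed.

(** F(y) is the representation with character chi on the functions supported
    at y, and every function is the product of its values at single points. *)
Lemma fun_char_onto (N : finType) (chi : {dffun forall _ : Y N, gT} -> k) :
    chi 1%g = 1 ->
    {in fun_group H Y N &, {morph chi : f g / (f * g)%g >-> f * g}} ->
  exists F : E N, {in fun_group H Y N, forall f, fun_char F f = chi f}.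
Proof.
move=> chi1 chiM.
have /fin_all_exists[F chiF] : forall y : Y N,
    exists i : Hhat, {in H, forall h, irr_mode i h = chi (single y h)}.
  move=> y; apply: irr_mode_onto => [|h h' Hh Hh'].
    by rewrite -[RHS]chi1; congr chi; apply/ffunP=> z; rewrite !ffunE if_same.
  rewrite -chiM ?single_group //; congr chi; apply/ffunP=> z; rewrite !ffunE.
  by case: ifP; rewrite // mulg1.
exists [ffun y => F y] => f /setXnP Hf.
(* The product over y is built one point at a time. *)
pose trunc (s : seq (Y N)) : {dffun forall _ : Y N, gT} :=
  [ffun z => if z \in s then f z else 1%g].
have truncG s : trunc s \in fun_group H Y N.
  by apply/setXnP=> z; rewrite ffunE; case: ifP.
have chi_trunc s : uniq s -> chi (trunc s) = \prod_(y <- s) chi (single y (f y)).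
  elim: s => [|y s IHs] /= => [_|/andP[ys /IHs eq_s]].
    by rewrite big_nil -chi1; congr chi; apply/ffunP=> z; rewrite !ffunE.
  rewrite big_cons -eq_s -chiM ?single_group //; congr chi; apply/ffunP=> z.
  rewrite !ffunE inE; case: eqP => [->|_] /=; last by rewrite mul1g.
  by rewrite (negPf ys) mulg1.
have -> : f = trunc (index_enum (Y N)).
  by apply/ffunP=> z; rewrite ffunE mem_index_enum.
rewrite chi_trunc ?index_enum_uniq //; apply: eq_bigr => y _.
by rewrite !ffunE mem_index_enum chiF.
Qed.

Lemma fun_group_abelian (N : finType) : abelian (fun_group H Y N).
Proof.
apply/centsP=> f /setXnP Hf g /setXnP Hg; apply/ffunP=> y; rewrite !ffunE.
exact: (centsP abH).
Qed.

Lemma fun_group_neq0 (N : finType) : #|fun_group H Y N|%:R != 0 :> k.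
Proof. by rewrite (pcharf0P k).1 // -lt0n cardG_gt0. Qed.

End FunCharacters.

(** * The Grothendieck group of Fun(Y_N, H) *)

(** A map that kills the relations descends to the quotient. *)
Lemma zlift_zrepr (T : choiceType) (U : zmodType) (R : {freeg T} -> Prop)
    (f : T -> U) d :
  (forall x, R x -> zlift f x = 0) -> zlift f (zrepr (zpi R d)) = zlift f d.
Proof.
move=> fR; have fB : zmod_morphism (zlift f) := @zliftB _ _ _.
suff ker x : zspan R x -> zlift f x = 0.
  by apply/eqP; rewrite -subr_eq0 -fB; apply/eqP/ker/zpi_eq; rewrite zpiK.
elim=> {x} [x /fR//||x y _ fx _ fy]; first exact: (zm0 fB).
by rewrite fB fx fy subrr.
Qed.

(** A simple submodule is a line, because the group is abelian. *)
Lemma common_eigenvector (F : fieldType) (gT : finGroupType) (G : {group gT})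
    (d : nat) (V : mx_representation F G d) :
    group_splitting_field F G -> abelian G -> (0 < d)%N ->
  exists (chi : gT -> F) (v : 'rV_d),
    [/\ v != 0, chi 1%g = 1,
        {in G &, {morph chi : x y / (x * y)%g >-> x * y}}
      & {in G, forall g, v *m V g = chi g *: v}].
Proof.
move=> splitG abG d_gt0.
have [v v0 stab_v] :
    exists2 v : 'rV[F]_d, v != 0 & forall g, g \in G -> (v *m V g <= v)%MS.
  (* Simple submodules exist classically, that is, in proofs of booleans. *)
  apply/asboolP.
  have d0 : (1%:M : 'M[F]_d) != 0 by rewrite -mxrank_eq0 mxrank1 -lt0n.
  apply: (mxsimple_exists (mxmodule1 V) d0) => -[U simU _].
  apply/asboolP; exists (nz_row U); first exact: (nz_row_mxsimple simU).
  have [modU _ _] := simU; move=> g Gg.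
  have eqU : (nz_row U :=: U)%MS.
    apply/eqmxP; rewrite nz_row_sub -(geq_leqif (mxrank_leqif_sup (nz_row_sub U))).
    rewrite (mxsimple_abelian_linear splitG abG simU) rank_rV.
    by rewrite (nz_row_mxsimple simU).
  rewrite (eqmxMr _ eqU) eqU; exact: (mxmoduleP modU).
pose chi g := (v *m V g *m pinvmx v) 0 0.
have chiE g : g \in G -> v *m V g = chi g *: v.
  move=> Gg; rewrite -[LHS](mulmxKpV (stab_v g Gg)).
  by rewrite [X in X *m _ = _]mx11_scalar mul_scalar_mx.
have inj_v a b : a *: v = b *: v -> a = b.
  move/eqP; rewrite -subr_eq0 -scalerBl scalemx_eq0 (negPf v0) orbF subr_eq0.
  by move/eqP.
exists chi, v; split=> // [|g h Gg Gh]; apply: inj_v.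
  by rewrite -chiE // repr_mx1 mulmx1 scale1r.
by rewrite -chiE ?groupM // repr_mxM // mulmxA chiE // -scalemxAl chiE // scalerA.
Qed.

Section Grothendieck.

Variables (k : closedFieldType) (gT : finGroupType) (H : {group gT}).
Hypotheses (char0 : [pchar k] =i pred0) (abH : abelian H).
Variables (Hhat : irrType k H) (Y : youngSet).

Local Notation E := (fun_species Hhat Y).

Lemma bcls_res (N M : finType) (w : bij N M) (F : E M) : bcls (res E w F) = bcls F.
Proof. exact: (cls_res id w F). Qed.

(** The coordinates of [V]: the multiplicities of the pi_F in V *)
Definition rep_coord (t : {classic fun_rep k H Y}) : BE E :=
  let: existT n (existT d V) := t in
  \sum_(F : E 'I_n) bcls F *+ mult (fun_char F) V.

(** Composition with Y_w identifies the groups Fun(Y_n, H) and Fun(Y_m, H), and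
    pi_F with pi_(F o Y_w). *)
Lemma isotypic_transport n m (w : bij 'I_n 'I_m) d
    (V : mx_representation k (fun_group H Y 'I_n) d)
    (wV : mx_representation k (fun_group H Y 'I_m) d) (F : E 'I_m) :
    {in fun_group H Y 'I_m, forall f,
      wV f = V ([ffun y => f (Ymap Y w y)] : {dffun forall _ : Y 'I_n, gT})} ->
  isotypic (fun_char F) wV = isotypic (fun_char (res E w F)) V.
Proof.
move=> wVE; have [v [vK Kv]] := bij_inv w.
have Yv z : Ymap Y v (Ymap Y w z) = z.
  by rewrite -Ymap_comp -[RHS]Ymap_id; apply: Ymap_eq => x; apply: vK.
have Yw z : Ymap Y w (Ymap Y v z) = z.
  by rewrite -Ymap_comp -[RHS]Ymap_id; apply: Ymap_eq => x; apply: Kv.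
pose h (f : {dffun forall _ : Y 'I_m, gT}) : {dffun forall _ : Y 'I_n, gT} :=
  [ffun y => f (Ymap Y w y)].
pose h' (f : {dffun forall _ : Y 'I_n, gT}) : {dffun forall _ : Y 'I_m, gT} :=
  [ffun y => f (Ymap Y v y)].
rewrite /isotypic [RHS](reindex h) /=; last first.
  by exists h' => f _; apply/ffunP=> y; rewrite !ffunE ?Yv ?Yw.
have hG f : (h f \in fun_group H Y 'I_n) = (f \in fun_group H Y 'I_m).
  apply/setXnP/setXnP => fH y; last by rewrite ffunE.
  by have := fH (Ymap Y v y); rewrite ffunE Yw.
apply: eq_big => [f|f Gf]; first by rewrite hG.
rewrite wVE //; congr (_ *: _); rewrite /fun_char.
rewrite (reindex (Ymap Y w)) /=; last by exists (Ymap Y v) => z _.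
by apply: eq_bigr => y _; rewrite resE !ffunE.
Qed.

Lemma rep_coord_rel x : BYH_rel x -> zlift rep_coord x = 0.
Proof.
have zB := @zliftB _ _ rep_coord.
case=> [n d d' d'' V V' V'' i p iV pV ifree pfull ker_p|n m w d V wV wVE].
  rewrite !zB !zliftU /= -!sumrB big1 // => F _.
  rewrite (mult_exact (fun_char1 F) (fun_charM abH F) (fun_group_neq0 _ _ _ _)
             iV pV ifree pfull ker_p) //.
  by rewrite mulrnDr addrAC addrK subrr.
have [v [vK Kv]] := bij_inv w.
rewrite zB !zliftU /= (reindex (res E w)); last first.
  by exists (res E v) => F _; rewrite -res_comp -[RHS](@res_id E); apply: res_eq.
apply/eqP; rewrite subr_eq0; apply/eqP/eq_bigr => F _.
by rewrite bcls_res /mult (isotypic_transport _ wVE).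
Qed.

Definition BYH_coord (x : BYH k H Y) : BE E := zlift rep_coord (zrepr x).

Lemma BYH_coord_zpi d : BYH_coord (zpi _ d) = zlift rep_coord d.
Proof. exact/zlift_zrepr/rep_coord_rel. Qed.

Lemma BYH_coordB : zmod_morphism BYH_coord.
Proof.
by move=> x y; rewrite -[x]zpiK -[y]zpiK -raddfB !BYH_coord_zpi zliftB.
Qed.

Lemma BYH_coord_pi n (F : E 'I_n) :
  BYH_coord (zpi _ << FunRep (pi_rep abH F) >>) = bcls F.
Proof.
have cF := fun_char1 F; have cFM := fun_charM abH F.
rewrite BYH_coord_zpi zliftU /= (bigD1 F) //=.
rewrite (_ : mult _ _ = 1%N); last first.
  by apply: mult_self => //; apply: fun_group_neq0.
rewrite big1 ?addr0 // => G GF.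
have [f Gf neq_f] := fun_char_sep char0 abH GF.
rewrite (_ : mult _ _ = 0%N) //; 
apply: (mult_other (psi := fun_char F f) (fun_char1 G) (fun_charM abH G) Gf) => //.
by rewrite eq_sym.
Qed.

Lemma zpi_pi_res n m (w : bij 'I_n 'I_m) (F : E 'I_m) :
  zpi (@BYH_rel k gT H Y) << FunRep (pi_rep abH (res E w F)) >>
    = zpi _ << FunRep (pi_rep abH F) >>.
Proof.
apply/zpi_eq/zspan_gen/(BYH_transport (w := w)) => f Gf /=.
have [v [vK Kv]] := bij_inv w.
rewrite /pi_fun; congr (_%:M); rewrite (reindex (Ymap Y w)) /=; last first.
  exists (Ymap Y v) => z _; rewrite -Ymap_comp -[RHS]Ymap_id; apply: Ymap_eq => x.
    exact: vK.
  exact: Kv.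
by apply: eq_bigr => y _; rewrite !ffunE.
Qed.

Lemma pi_cls_res (N M : finType) (w : bij N M) (F : E M) :
  pi_cls abH (res E w F) = pi_cls abH F.
Proof.
have [u [uK Ku]] := bij_inv (std_bij M).
rewrite /pi_cls -(zpi_pi_res (comp_bij u (comp_bij w (std_bij N)))).
rewrite -!res_comp; congr (zpi _ << FunRep (pi_rep abH _) >>).
by apply: res_eq => x; apply/esym/Ku.
Qed.

Lemma pi_cls_ord n (F : E 'I_n) : pi_cls abH F = zpi _ << FunRep (pi_rep abH F) >>.
Proof. exact: (zpi_pi_res (std_bij 'I_n)). Qed.

Definition BYH_comb : BE E -> BYH k H Y :=
  zlift (fun c : iso_class E => pi_cls abH (tagged (generic_quotient.repr c))).

Lemma BYH_combB : zmod_morphism BYH_comb.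
Proof. exact: zliftB. Qed.

Lemma BYH_comb_bcls (N : finType) (F : E N) : BYH_comb (bcls F) = pi_cls abH F.
Proof.
rewrite /BYH_comb zliftU; have [w <-] := iso_class_repr F; exact: pi_cls_res.
Qed.

Lemma BYH_coord_cls (N : finType) (F : E N) : BYH_coord (pi_cls abH F) = bcls F.
Proof. by rewrite BYH_coord_pi (bcls_res (std_bij N)). Qed.

Lemma BYH_combK : cancel BYH_comb BYH_coord.
Proof.
apply: (@cls_ext _ _ _ Hhat Y _ id id (fun _ _ => erefl) (fun _ => erefl) _
          (fun x => BYH_coord (BYH_comb x)) id) => // [x y|N F].
  by rewrite BYH_combB BYH_coordB.
by rewrite BYH_comb_bcls BYH_coord_cls.
Qed.

Lemma zpi_exact n d d' d'' (V : mx_representation k (fun_group H Y 'I_n) d)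
    (V' : mx_representation k (fun_group H Y 'I_n) d')
    (V'' : mx_representation k (fun_group H Y 'I_n) d'')
    (i : 'M[k]_(d', d)) (p : 'M[k]_(d, d'')) :
  {in fun_group H Y 'I_n, forall f, V' f *m i = i *m V f} ->
  {in fun_group H Y 'I_n, forall f, V f *m p = p *m V'' f} ->
  row_free i -> row_full p -> (i :=: kermx p)%MS ->
  zpi (@BYH_rel k gT H Y) << FunRep V >>
    = zpi _ << FunRep V' >> + zpi _ << FunRep V'' >>.
Proof.
move=> iV pV ifree pfull ker_p; apply/eqP; rewrite -subr_eq0 opprD addrA -!raddfB.
rewrite -(raddf0 (zpi _)); apply/eqP/zpi_eq; rewrite subr0; apply: zspan_gen.
exact: BYH_exact ker_p.
Qed.

(** A representation of positive dimension contains some pi_F, as Fun(Y_N, H)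
    is abelian; the claim follows by induction on the dimension. *)
Lemma zpi_rep_coordK n d (V : mx_representation k (fun_group H Y 'I_n) d) :
  BYH_comb (BYH_coord (zpi _ << FunRep V >>)) = zpi _ << FunRep V >>.
Proof.
have [m] := ubnP d; elim: m d V => // m IHm d V; rewrite ltnS => dm.
have [d0|d_gt0] := posnP d.
  (* The zero representation is an extension of itself by itself. *)
  have V0 : zpi (@BYH_rel k gT H Y) << FunRep V >> = 0.
    move: V; rewrite d0 => V.
    apply: (addrI (zpi _ << FunRep V >>)); rewrite addr0; apply/esym.
    apply: (@zpi_exact n 0 0 0 V V V 0 0) => [f _|f _|||].
    - by rewrite mulmx0 mul0mx.
    - by rewrite mulmx0 mul0mx.
    - by rewrite /row_free mxrank0.
    - by rewrite /row_full mxrank0.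
    - by rewrite [kermx _]flatmx0.
  by rewrite V0 (zm0 BYH_coordB) (zm0 BYH_combB).
have [chi [v [v0 chi1 chiM vV]]] :=
  common_eigenvector V (@group_closure_closed_field _ _ _)
    (fun_group_abelian abH Y _) d_gt0.
have [F chiF] := fun_char_onto char0 abH Hhat chi1 chiM.
have modU : mxmodule V <<v>>%MS.
  by apply/mxmoduleP=> f Gf; rewrite (eqmxMr _ (genmxE v)) genmxE vV // scalemx_sub.
(* The line spanned by v is a copy of pi_F, and the quotient by it has smaller
   dimension. *)
have exV : zpi (@BYH_rel k gT H Y) << FunRep V >>
    = zpi _ << FunRep (pi_rep abH F) >> + zpi _ << FunRep (factmod_repr modU) >>.
  apply: (@zpi_exact _ _ _ _ V (pi_rep abH F) (factmod_repr modU) v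
            (in_factmod <<v>>%MS 1%:M)).
  - by move=> f Gf; rewrite vV // -chiF // mul_scalar_mx.
  - by move=> f Gf; rewrite -in_factmodE -[V f in LHS]mul1mx in_factmodJ.
  - by rewrite /row_free rank_rV v0.
  - by rewrite /in_factmod /= mul1mx col_base_full.
  - apply/eqmxP/andP; split.
      by apply/sub_kermxP; rewrite -in_factmodE; apply/eqP; rewrite in_factmod_eq0 genmxE.
    rewrite -(genmxE v) -in_factmod_eq0 in_factmodE; apply/eqP; exact: mulmx_ker.
rewrite exV -[X in _ + X]opprK !(BYH_coordB, BYH_combB) -pi_cls_ord.
rewrite BYH_coord_cls BYH_comb_bcls; congr (_ - _).
rewrite (zmN BYH_coordB) (zmN BYH_combB) IHm //.
rewrite mxrank_coker genmxE rank_rV v0; apply: leq_trans dm.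
by rewrite subn1 prednK.
Qed.

Lemma BYH_coordK : cancel BYH_coord BYH_comb.
Proof.
move=> x; rewrite -[x]zpiK; elim/freeg_span: (zrepr x) => [|d d' IHd IHd'|].
- by rewrite raddf0 (zm0 BYH_coordB) (zm0 BYH_combB).
- by rewrite raddfB BYH_coordB BYH_combB IHd IHd'.
- by case=> n [d V]; apply: zpi_rep_coordK.
Qed.

End Grothendieck.

(** * The Hopf algebras of functions *)

Section Main.

Variables (k : closedFieldType) (gT : finGroupType) (H : {group gT}).
Hypothesis abH : abelian H.
Variables (Hhat : irrType k H) (Y : youngSet).

Local Notation E := (fun_species Hhat Y).
Local Notation P := (prim_species Hhat Y).
Local Notation Phi := (assemble Hhat Y).

Lemma fun_void_eq (F G : E void) : F = G.
Proof. by apply/ffunP=> y; case: (Yvoid y). Qed.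

Lemma is_BE_cls_hopf (B : hopf (BE E)) :
  is_BE E P Phi B <-> cls_hopf (Hhat := Hhat) (Y := Y) id B.
Proof.
split=> -[mulB oneB copB couB]; split=> //.
- by move=> N K u uK; apply: mulB; apply/is_dunionP.
- by move=> F; rewrite oneB; congr (bcls _); apply: fun_void_eq.
- by move=> N K s t u /is_dunionP[<- <- uK]; apply: mulB.
- exact: oneB.
Qed.

Lemma is_BYH_cls_hopf (A : hopf (BYH k H Y)) :
  is_BYH Hhat abH A <-> cls_hopf (BYH_comb abH (Hhat := Hhat) (Y := Y)) A.
Proof.
have clsE (N : finType) (F : E N) :
    cls (BYH_comb abH (Hhat := Hhat) (Y := Y)) F = pi_cls abH F.
  exact: BYH_comb_bcls.
split=> -[mulA oneA copA couA]; split.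
- by move=> N K u uK; rewrite !clsE mulA fun_dunionE.
- by move=> F; rewrite clsE.
- by move=> N F; rewrite clsE copA; apply: eq_bigr => K _; rewrite !clsE.
- by move=> N F; rewrite clsE couA.
- move=> N K F G.
  have [eF eG uK] := fun_dunionP F G.
  by have := mulA _ _ _ uK; rewrite !clsE eF eG.
- by move=> F; rewrite -clsE.
- by move=> N F; rewrite -clsE copA; apply: eq_bigr => K _; rewrite !clsE.
- by move=> N F; rewrite -clsE couA.
Qed.

End Main.

Theorem proposition3p27 (k : closedFieldType) (char0 : ([pchar k] =i pred0)%R)
    (gT : finGroupType) (H : {group gT}) (abH : abelian H)
    (Hhat : irrType k H) (Y : youngSet) :
  let E := fun_species Hhat Y in
  let P := prim_species Hhat Y in
  let Phi := assemble Hhat Y in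
  (exponential E P Phi /\ coherent E P Phi)
  /\ [/\ exists A : hopf (BYH k H Y), is_BYH Hhat abH A,
         exists B : hopf (BE E), is_BE E P Phi B
       & forall (A : hopf (BYH k H Y)) (B : hopf (BE E)),
           is_BYH Hhat abH A -> is_BE E P Phi B -> hopf_isomorphic A B].
Proof.
move=> E P Phi; have idB (V : zmodType) : zmod_morphism (@id V) by [].
have coordB := @BYH_coordB k gT H char0 abH Hhat Y.
have combB := @BYH_combB k gT H abH Hhat Y.
have coordK := @BYH_coordK k gT H char0 abH Hhat Y.
have combK := @BYH_combK k gT H char0 abH Hhat Y.
split; first by split; [apply: fun_species_exponential | apply: fun_species_coherent].
split.
- have [A hA] := cls_hopf_exists coordB combB coordK combK.
  by exists A; apply/is_BYH_cls_hopf.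
- have [B hB] := cls_hopf_exists (idB (BE E)) (idB _) (fun=> erefl) (fun=> erefl).
  by exists B; apply/is_BE_cls_hopf.
- move=> A B /is_BYH_cls_hopf hA /is_BE_cls_hopf hB.
  exact: (cls_hopf_isomorphic coordB combB coordK combK (idB _) (idB _)
            (fun=> erefl) (fun=> erefl) hA hB).
Qed.
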